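(* The functions ${\bf u}^N=\sum_{\alpha=1}^N{\bf 1}_{[z_{\alpha-1/2},z_{\alpha+1/2}]}(z)\,{\bf u}_\alpha(t,x,y)$ and $h$ (with $h>0$) are strong solutions of the layer-averaged Euler system $$\sum_{\alpha=1}^N\frac{\partial h_\alpha}{\partial t}+\sum_{\alpha=1}^N\nabla_{x,y}\cdot(h_\alpha{\bf u}_\alpha)=0,$$ $$\frac{\partial (h_\alpha{\bf u}_\alpha)}{\partial t}+\nabla_{x,y}\cdot(h_\alpha{\bf u}_\alpha\otimes{\bf u}_\alpha)+\nabla_{x,y}\Bigl(\frac g2hh_\alpha\Bigr)=-gh_\alpha\nabla_{x,y}z_b+{\bf u}_{\alpha+1/2}G_{\alpha+1/2}-{\bf u}_{\alpha-1/2}G_{\alpha-1/2},\quad\alpha=1,\dots,N,$$ if and only if the sets of equilibria $\{M_\alpha\}_{\alpha=1}^N$, $\{N_{\alpha+1/2}\}_{\alpha=0}^N$ are solutions of the kinetic equations $$\frac{\partial M_\alpha}{\partial t}+\begin{pmatrix}\xi\\\gamma\end{pmatrix}\cdot\nabla_{x,y}M_\alpha-g\nabla_{x,y}z_b\cdot\nabla_{\xi,\gamma}M_\alpha-N_{\alpha+1/2}+N_{\alpha-1/2}=Q_\alpha,\qquad\alpha=1,\dots,N,$$ where the collision terms $Q_\alpha=Q_\alpha(t,x,y,\xi,\gamma)$ satisfy, for a.e. $(t,x,y)$, $$\int_{\mathbb{R}^2}Q_\alpha\,d\xi d\gamma=\int_{\mathbb{R}^2}\xi Q_\alpha\,d\xi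 d\gamma=\int_{\mathbb{R}^2}\gamma Q_\alpha\,d\xi d\gamma=0.$$
   Context: $z_b(x,y)$ is the bottom topography, $h(t,x,y)$ the water depth, $g>0$, ${\bf u}_\alpha=(u_\alpha,v_\alpha)^T$; $\nabla_{x,y}=(\partial_x,\partial_y)^T$, $\nabla_{\xi,\gamma}=(\partial_\xi,\partial_\gamma)^T$; $l_1,\dots,l_N>0$ are constants with $\sum l_\alpha=1$, $h_\alpha=l_\alpha h$, $z_{\alpha+1/2}=z_b+\sum_{j\le\alpha}h_j$. For $\alpha=0,\dots,N$, $G_{\alpha+1/2}=-\sum_{j=1}^N\bigl(\sum_{p=1}^\alpha l_p-{\bf 1}_{j\le\alpha}\bigr)\nabla_{x,y}\cdot(h_j{\bf u}_j)$ (so $G_{1/2}=G_{N+1/2}=0$); ${\bf u}_{\alpha+1/2}=(u_{\alpha+1/2},v_{\alpha+1/2})^T$ equals ${\bf u}_\alpha$ if $G_{\alpha+1/2}\le0$ and ${\bf u}_{\alpha+1}$ if $G_{\alpha+1/2}>0$. With $\chi_0(z_1,z_2)=\frac1{4\pi}{\bf 1}_{z_1^2+z_2^2\le4}$ and $c=\sqrt{gh/2}$, the equilibria are, for $(\xi,\gamma)\in\mathbb{R}^2$, $$M_\alpha=\frac{h_\alpha}{c^2}\chi_0\Bigl(\frac{\xi-u_\alpha}c,\frac{\gamma-v_\alpha}c\Bigr)=\frac{l_\alpha}{2g\pi}{\bf 1}_{(\xi-u_\alpha)^2+(\gamma-v_\alpha)^2\le2gh},\qquad N_{\alpha+1/2}=\frac{G_{\alpha+1/2}}{c^2}\chi_0\Bigl(\frac{\xi-u_{\alpha+1/2}}c,\frac{\gamma-v_{\alpha+1/2}}c\Bigr).$$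 Derivatives of $M_\alpha$ are in the sense of distributions, and $\xi,\gamma$-moments of the kinetic equation are computed by taking the $t,x,y$ derivatives out of the integrals and integrating by parts in $(\xi,\gamma)$. *)

(* Defs.v *)
From HB Require Import structures.
From mathcomp Require Import all_boot all_order all_algebra.
From mathcomp Require Import all_classical all_reals all_analysis.

Set Implicit Arguments.
Unset Strict Implicit.
Unset Printing Implicit Defensive.

Import Order.TTheory GRing.Theory Num.Theory.
Import numFieldNormedType.Exports.

Local Open Scope classical_set_scope.
Local Open Scope ring_scope.

(* The product measure again: the library's canonical structures only find
   that m1 \x m2 is sigma-finite for subprobabilities, which prevents iterating
   the product. *)
Section SigmaFiniteProduct.
Context d1 d2 (T1 : measurableType d1) (T2 : measurableType d2) (R : realType).
Variables (m1 : {sigma_finite_measure set T1 -> \bar R})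
          (m2 : {sigma_finite_measure set T2 -> \bar R}).

Definition sf_prod : set (T1 * T2) -> \bar R := (m1 \x m2)%E.

HB.instance Definition _ := Measure.on sf_prod.

Lemma sf_prod_sigma_finite : sigma_finite setT sf_prod.
Proof.
have /sigma_finiteP[F [TF ndF Foo]] := sigma_finiteT m1.
have /sigma_finiteP[G [TG ndG Goo]] := sigma_finiteT m2.
exists (fun n => F n `*` G n).
  rewrite -setXTT TF TG predeqE => -[x y]; split.
    move=> [/= [n _ Fnx] [k _ Gky]]; exists (maxn n k) => //; split.
    - by move: x Fnx; exact/subsetPset/ndF/leq_maxl.
    - by move: y Gky; exact/subsetPset/ndG/leq_maxr.
  by move=> [n _ []/= ? ?]; split; exists n.
move=> k; have [? ?] := Foo k; have [? ?] := Goo k.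
split; first exact: measurableX.
by rewrite /sf_prod product_measure1E// lte_mul_pinfty// ge0_fin_numE.
Qed.

HB.instance Definition _ :=
  Measure_isSigmaFinite.Build _ _ _ sf_prod sf_prod_sigma_finite.

End SigmaFiniteProduct.

(* C^k regularity on an open set D, phrased without coordinates: all the
   directional derivatives exist on D and are of class C^(k-1) there.  On a
   finite-dimensional V this is the usual condition on partial derivatives. *)
Fixpoint Ck (R : realType) (V W : normedModType R) (k : nat) (D : set V)
    (f : V -> W) : Prop :=
  (forall x, D x -> {for x, continuous f}) /\
  (if k is k'.+1 then
     forall v : V, (forall x, D x -> derivable f x v) /\ Ck k' D ('D_v f)
   else True).

Section Distributions.
Context {R : realType} {V : normedModType R}.

Definition smooth (f : V -> R) : Prop := forall k, Ck k setT f.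

Definition supp (f : V -> R) : set V := closure [set x | f x != 0].

Definition test_function (D : set V) (phi : V -> R) : Prop :=
  [/\ smooth phi, compact (supp phi) & supp phi `<=` D].

Definition iter_derive (vs : seq V) (f : V -> R) : V -> R :=
  foldr (fun v f' => 'D_v f') f vs.

(* T only matters on test functions.  The second clause is the seminorm
   estimate on compact sets: the directions range over the unit ball, so B
   bounds all the derivatives of phi of order at most m. *)
Definition distribution_on (D : set V) (T : (V -> R) -> R) : Prop :=
  (forall (a : R) (phi psi : V -> R),
     test_function D phi -> test_function D psi ->
     T (fun x => a * phi x + psi x) = a * T phi + T psi) /\
  (forall K : set V, compact K -> K `<=` D ->
     exists (m : nat) (C : R), forall (phi : V -> R) (B : R),
       test_function D phi -> supp phi `<=` K ->
       (forall (vs : seq V) (x : V), (size vs <= m)%N ->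
          (forall v, v \in vs -> `|v| <= 1) -> `|iter_derive vs phi x| <= B) ->
       `|T phi| <= C * B).

Definition distr_derive (v : V) (T : (V -> R) -> R) : (V -> R) -> R :=
  fun phi => - T ('D_v phi).

End Distributions.

Section LayerAveragedEuler.
Variable R : realType.

(* (t, (x, y)), (xi, gamma), and ((t, (x, y)), (xi, gamma)) *)
Definition spacetime : normedModType R := (R * (R * R))%type.
Definition velocity : normedModType R := (R * R)%type.
Definition phase : normedModType R := (spacetime * velocity)%type.

Local Notation mR := (measurableTypeR R).

Definition leb2 : {sigma_finite_measure set (mR * mR)%type -> \bar R} :=
  sf_prod (@lebesgue_measure R) (@lebesgue_measure R).
Definition leb3 :
    {sigma_finite_measure set (mR * (mR * mR))%type -> \bar R} :=
  sf_prod (@lebesgue_measure R) leb2.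
Definition leb5 :
    {sigma_finite_measure set ((mR * (mR * mR)) * (mR * mR))%type -> \bar R} :=
  sf_prod leb3 leb2.

Definition e_t : spacetime := (1, (0, 0)).
Definition e_x : spacetime := (0, (1, 0)).
Definition e_y : spacetime := (0, (0, 1)).
Definition e_xi : velocity := (1, 0).
Definition e_gamma : velocity := (0, 1).

Definition grad (f : spacetime -> R) (p : spacetime) : velocity :=
  ('D_e_x f p, 'D_e_y f p).

Definition div (F : spacetime -> velocity) (p : spacetime) : R :=
  'D_e_x (fun q => (F q).1) p + 'D_e_y (fun q => (F q).2) p.

(* div (a (x) b) = d_x (b_1 a) + d_y (b_2 a) *)
Definition div_tensor (a b : spacetime -> velocity) (p : spacetime) : velocity :=
  'D_e_x (fun q => (b q).1 *: a q) p + 'D_e_y (fun q => (b q).2 *: a q) p.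

(* Layers are numbered 1, ..., N and the interface alpha + 1/2 has index alpha;
   the values of l and u at other indices are irrelevant (in particular u 0
   only occurs multiplied by G_{1/2} = 0). *)
Variables (g : R) (N : nat) (l : nat -> R) (zb : R * R -> R).

Section Fields.
Variables (h : spacetime -> R) (u : nat -> spacetime -> velocity).

Definition layer_depth (a : nat) (p : spacetime) : R := l a * h p.

Definition discharge (a : nat) (p : spacetime) : velocity :=
  layer_depth a p *: u a p.

Definition bottom (p : spacetime) : R := zb p.2.

Definition interface (a : nat) (p : spacetime) : R :=
  bottom p + \sum_(1 <= j < a.+1) layer_depth j p.

Definition exchange (a : nat) (p : spacetime) : R :=
  - \sum_(1 <= j < N.+1)
      (\sum_(1 <= i < a.+1) l i - (j <= a)%N%:R) * div (discharge j) p.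

Definition upwind (a : nat) (p : spacetime) : velocity :=
  if exchange a p <= 0 then u a p else u a.+1 p.

Definition layered_velocity (p : spacetime) (z : R) : velocity :=
  \sum_(1 <= a < N.+1)
     (interface a.-1 p <= z <= interface a p)%R%:R *: u a p.

Definition mass_equation (p : spacetime) : Prop :=
  \sum_(1 <= a < N.+1) 'D_e_t (layer_depth a) p
  + \sum_(1 <= a < N.+1) div (discharge a) p = 0.

Definition momentum_equation (a : nat) (p : spacetime) : Prop :=
  'D_e_t (discharge a) p + div_tensor (discharge a) (u a) p
  + grad (fun q => g / 2 * (h q * layer_depth a q)) p
  = - (g * layer_depth a p) *: grad bottom p
    + exchange a p *: upwind a p - exchange a.-1 p *: upwind a.-1 p.

Definition chi0 (z1 z2 : R) : R :=
  (4 * pi)^-1 * (z1 ^+ 2 + z2 ^+ 2 <= 4)%R%:R.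

Definition celerity (p : spacetime) : R := Num.sqrt (g * h p / 2).

(* (m / c^2) chi0 ((xi - w_1) / c, (gamma - w_2) / c) *)
Definition equilibrium (m : spacetime -> R) (w : spacetime -> velocity)
    (q : phase) : R :=
  m q.1 / celerity q.1 ^+ 2
  * chi0 ((q.2.1 - (w q.1).1) / celerity q.1)
         ((q.2.2 - (w q.1).2) / celerity q.1).

Definition Meq (a : nat) : phase -> R := equilibrium (layer_depth a) (u a).

Definition Neq (a : nat) : phase -> R := equilibrium (exchange a) (upwind a).

End Fields.

Section Domain.
(* The open set of points (t, (x, y)) where the equations are considered. *)
Variable Omega : set spacetime.

Definition phase_domain : set phase := Omega `*` setT.

Definition distr_of (F : phase -> R) : (phase -> R) -> R :=
  fun phi => \int[leb5]_(q in phase_domain) (F q * phi q).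

(* Left-hand side of the kinetic equation.  The coefficients of the derivatives
   of M do not depend on the variable of differentiation, so that
   xi d_x M = d_x (xi M), (d_x z_b) d_xi M = d_xi ((d_x z_b) M), and so on; the
   right-hand sides make sense even though M and d_x z_b are not smooth. *)
Definition kinetic_operator (h : spacetime -> R)
    (u : nat -> spacetime -> velocity) (a : nat) (phi : phase -> R) : R :=
  let M := Meq h u a in
  distr_derive (e_t, 0) (distr_of M) phi
  + distr_derive (e_x, 0) (distr_of (fun q => q.2.1 * M q)) phi
  + distr_derive (e_y, 0) (distr_of (fun q => q.2.2 * M q)) phi
  - distr_derive (0, e_xi) (distr_of (fun q => g * (grad bottom q.1).1 * M q)) phi
  - distr_derive (0, e_gamma) (distr_of (fun q => g * (grad bottom q.1).2 * M q)) phi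
  - distr_of (Neq h u a) phi
  + distr_of (Neq h u a.-1) phi.

Definition locally_integrable_on (m : spacetime -> R) : Prop :=
  forall K : set spacetime, compact K -> K `<=` Omega ->
    leb3.-integrable K (EFin \o m).

(* m(t,x,y) = int w(xi,gamma) Q(t,x,y,xi,gamma) dxi dgamma for a distribution Q:
   since w is not compactly supported, it is multiplied by cutoffs chi, and the
   result must not depend on chi once chi = 1 on a large enough ball. *)
Definition velocity_moment (Q : (phase -> R) -> R) (w : velocity -> R)
    (m : spacetime -> R) : Prop :=
  locally_integrable_on m /\
  forall phi : spacetime -> R, test_function Omega phi ->
    exists r : R, forall chi : velocity -> R, test_function setT chi ->
      (forall z, `|z| <= r -> chi z = 1) ->
      Q (fun q => phi q.1 * (w q.2 * chi q.2))
      = \int[leb3]_(p in Omega) (m p * phi p).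

Definition vanishing_moment (Q : (phase -> R) -> R) (w : velocity -> R) : Prop :=
  exists m : spacetime -> R,
    velocity_moment Q w m /\ {ae leb3, forall p, Omega p -> m p = 0}.

Definition kinetic_solution (h : spacetime -> R)
    (u : nat -> spacetime -> velocity) : Prop :=
  exists Q : nat -> (phase -> R) -> R, forall a, (1 <= a <= N)%N ->
    [/\ distribution_on phase_domain (Q a),
        (forall phi, test_function phase_domain phi ->
           kinetic_operator h u a phi = Q a phi),
        vanishing_moment (Q a) (fun=> 1),
        vanishing_moment (Q a) (fun z => z.1) &
        vanishing_moment (Q a) (fun z => z.2)].

(* Since the layers are nondegenerate, the family u below is determined on
   Omega by the layerwise constant field uN. *)
Definition euler_strong_solution (h : spacetime -> R)
    (uN : spacetime -> R -> velocity) : Prop :=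
  Ck 1 Omega h /\
  exists u : nat -> spacetime -> velocity,
    [/\ (forall a, (1 <= a <= N)%N -> Ck 1 Omega (u a)),
        (forall p z, Omega p -> uN p z = layered_velocity h u p z) &
        forall p, Omega p ->
          mass_equation h u p /\
          (forall a, (1 <= a <= N)%N -> momentum_equation h u a p)].

End Domain.
End LayerAveragedEuler.

(* Main.v *)
(* Integrating the kinetic equation against 1, xi and gamma turns the moments of
   the equilibria into the conserved quantities and their fluxes: the
   uniform distribution on the disk of centre u_alpha and squared radius 2 g h
   has mass h_alpha, mean u_alpha and variance g h / 2 in each direction, which
   is the pressure (g / 2) h h_alpha.  Hence the moments of the left-hand side
   of the kinetic equation, tested against phi(t, x, y) times a velocity cutoff,
   are the integrals of phi times the residuals of the mass and momentum
   equations of the layer.  If the residuals vanish, the left-hand side itself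
   is the required Q_alpha; conversely vanishing moments give vanishing
   residuals by the fundamental lemma of the calculus of variations.  The mass
   equation of one layer, with its exchange terms, is l_alpha times the total
   mass equation. *)
Require Import Defs.
From mathcomp Require Import all_boot all_order all_algebra.
From mathcomp Require Import all_classical all_reals all_analysis.
From mathcomp Require Import measurable_realfun ring lra.
Import Order.TTheory GRing.Theory Num.Theory.
Import numFieldNormedType.Exports.
Local Open Scope classical_set_scope.
Local Open Scope ring_scope.
Set Implicit Arguments.
Unset Strict Implicit.
Unset Printing Implicit Defensive.

(** * Measurability of continuous functions *)

(** The equilibria are multiples of indicators of moving disks, so no derivative of them can be
    taken pointwise: each one is moved onto a test function of product form, [phi] in space-time
    times an affine weight times a cutoff in velocity. The unbounded weights are made admissible by
    compactness: over [supp phi] the centres and the celerity are bounded, so all velocity supports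
    lie in one open ball, and a cutoff equal to 1 there is invisible, derivatives included. The
    radius depends on [phi] but not on the weight, so the three moments are handled together with
    free coefficients [a0], [a1], [a2]. Vanishing moments are known almost everywhere, hence only in
    integrated form; pointwise equations come back because the residuals are continuous. This is not
    immediate, as the upwind velocity jumps, but it jumps only where the exchange term vanishes, so
    their product is continuous. On the Euler side the velocities are given only through the layered
    field, and must first be identified with [u] on [Omega] for the layers 1 to [N]. *)

Definition base_family (T : topologicalType) (I : Type) (B : I -> set T) :=
  forall (U : set T) x, open U -> U x -> exists i, B i x /\ B i `<=` U.

Lemma base_family_prod (T1 T2 : topologicalType) (I1 I2 : Type)
    (B1 : I1 -> set T1) (B2 : I2 -> set T2) :
  base_family B1 -> base_family B2 ->
  base_family (fun i : I1 * I2 => B1 i.1 `*` B2 i.2).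
Proof.
move=> b1 b2 U [x y] /= oU Uxy.
have : nbhs (x, y) U by exact: open_nbhs_nbhs.
move=> [[A1 A2] /= [nA1 nA2] sA].
have [i [Bi si]] := b1 _ x (open_interior A1) nA1.
have [j [Bj sj]] := b2 _ y (open_interior A2) nA2.
exists (i, j); split=> //= -[a b] [/= /si Aa /sj Ab]; apply: sA; split => /=.
  exact: (interior_subset Aa).
exact: (interior_subset Ab).
Qed.

(** Rational endpoints keep the index type countable, and products of such families stay
    countable. *)
Lemma base_family_real (R : realType) :
  base_family (fun i : rat * rat => `]ratr i.1, (ratr i.2 : R)[%classic : set R).
Proof.
move=> U x oU Ux.
have : nbhs x U by exact: open_nbhs_nbhs.
move=> /nbhs_ballP [e /= e0 sU].
have [a] := rat_in_itvoo (ltac:(by rewrite ltrBlDr ltrDl) : x - e < x).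
rewrite in_itv /= => /andP[a1 a2].
have [b] := rat_in_itvoo (ltac:(by rewrite ltrDl) : x < x + e).
rewrite in_itv /= => /andP[b1 b2].
exists (a, b); split => /=; first by rewrite in_itv /= a2 b1.
move=> y /=; rewrite in_itv /= => /andP[y1 y2]; apply: sU.
by rewrite /ball /= ltr_distlC (lt_trans a1 y1) (lt_trans y2 b2).
Qed.

(** [M] stands for the measurable sets of a product sigma-algebra, which is generated by rectangles
    and not by the topology. Open sets therefore have to be written as countable unions of boxes;
    [unpickle] enumerates the indices, and boxes not contained in [U] are replaced by the empty
    set. *)
Lemma open_countable_union (T : topologicalType) (I : countType)
    (B : I -> set T) (M : set (set T)) :
  base_family B -> M set0 -> (forall i, M (B i)) ->
  (forall F : nat -> set T, (forall n, M (F n)) -> M (\bigcup_n F n)) ->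
  forall U, open U -> M U.
Proof.
move=> bB M0 MB MU U oU.
pose F n := if unpickle n is Some i then
   (if `[< B i `<=` U >] then B i else set0) else set0.
have -> : U = \bigcup_n F n.
  apply/seteqP; split=> [x Ux|x [n _]].
    have [i [Bix sB]] := bB _ _ oU Ux.
    exists (pickle i) => //; rewrite /F pickleK.
    by case: asboolP.
  rewrite /F; case: unpickle => [i|] //; case: asboolP => // sB; exact: sB.
apply: MU => n; rewrite /F; case: unpickle => [i|] //.
by case: ifP.
Qed.

Section MeasurabilityOfContinuous.
Variable R : realType.
Local Notation mR := (measurableTypeR R).

Lemma open_measurable2 (U : set (R * R)) :
  open U -> measurable (U : set (mR * mR)).
Proof.
apply: (open_countable_union (base_family_prod (@base_family_real R)
  (@base_family_real R))).
- exact: measurable0.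
- by move=> [i j]; apply: measurableX; exact: measurable_itv.
- by move=> F mF; exact: bigcup_measurable.
Qed.

Lemma open_measurable3 (U : set (spacetime R)) :
  open U -> measurable (U : set (mR * (mR * mR))).
Proof.
apply: (open_countable_union (base_family_prod (@base_family_real R)
  (base_family_prod (@base_family_real R) (@base_family_real R)))).
- exact: measurable0.
- by move=> [i [j k]]; do! [apply: measurableX]; exact: measurable_itv.
- by move=> F mF; exact: bigcup_measurable.
Qed.

Lemma open_measurable5 (U : set (phase R)) :
  open U -> measurable (U : set ((mR * (mR * mR)) * (mR * mR))).
Proof.
apply: (open_countable_union (base_family_prod (base_family_prod (@base_family_real R)
  (base_family_prod (@base_family_real R) (@base_family_real R)))
  (base_family_prod (@base_family_real R) (@base_family_real R)))).
- exact: measurable0.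
- by move=> [[i [j k]] [a b]]; do! [apply: measurableX]; exact: measurable_itv.
- by move=> F mF; exact: bigcup_measurable.
Qed.

Lemma preimage_open (T U : topologicalType) (D : set T) (f : T -> U) (V : set U) :
  open D -> (forall x, D x -> {for x, continuous f}) -> open V ->
  open (D `&` f @^-1` V).
Proof.
move=> oD cf oV; rewrite openE => x [Dx Vx].
apply: filterI; first exact: open_nbhs_nbhs.
by apply: (cf x Dx); apply: open_nbhs_nbhs.
Qed.

Lemma measurable_fun_open d (T : measurableType d) (D : set T) (f : T -> R) :
  (forall V : set R, open V -> measurable (D `&` f @^-1` V)) ->
  measurable_fun D (f : T -> mR).
Proof.
move=> H; apply: (measurability _ (measurable_realfun.RGenOpens.measurableE R)).
move=> _ [_ [a [b ->] <-]]; exact/H/interval_open.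
Qed.

Lemma continuous_measurable2 (D : set (R * R)) (f : R * R -> R) :
  open D -> (forall x, D x -> {for x, continuous f}) ->
  measurable_fun (D : set (mR * mR)) (f : _ -> mR).
Proof.
move=> oD cf; apply: measurable_fun_open => V oV.
by apply: open_measurable2; exact: preimage_open.
Qed.

Lemma continuous_measurable3 (D : set (spacetime R)) (f : spacetime R -> R) :
  open D -> (forall x, D x -> {for x, continuous f}) ->
  measurable_fun (D : set (mR * (mR * mR))) (f : _ -> mR).
Proof.
move=> oD cf; apply: measurable_fun_open => V oV.
by apply: open_measurable3; exact: preimage_open.
Qed.

Lemma continuous_measurable5 (D : set (phase R)) (f : phase R -> R) :
  open D -> (forall x, D x -> {for x, continuous f}) ->
  measurable_fun (D : set ((mR * (mR * mR)) * (mR * mR))) (f : _ -> mR).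
Proof.
move=> oD cf; apply: measurable_fun_open => V oV.
by apply: open_measurable5; exact: preimage_open.
Qed.

End MeasurabilityOfContinuous.

(** * Functions of class C^k *)

Section CkCalculus.
Variable R : realType.
Implicit Types V W : normedModType R.

Lemma near_open (T : topologicalType) (D : set T) (P : T -> Prop) x :
  open D -> D x -> (forall y, D y -> P y) -> \near x, P x.
Proof.
by move=> oD Dx DP; apply: filterS (open_nbhs_nbhs (conj oD Dx)) => y /DP.
Qed.

Lemma near_continuous (T U : topologicalType) (f g : T -> U) x :
  (\near x, f x = g x) -> {for x, continuous f} -> {for x, continuous g}.
Proof.
move=> fg cf; rewrite /prop_for /continuous_at -(nbhs_singleton fg).
by apply: cvg_trans cf; apply: near_eq_cvg; apply: filterS fg => y ->.
Qed.

Lemma Ck_continuous V W k (D : set V) (f : V -> W) :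
  Ck k D f -> forall x, D x -> {for x, continuous f}.
Proof. by case: k => [|k] []. Qed.

Lemma CkW V W k (D : set V) (f : V -> W) : Ck k.+1 D f -> Ck k D f.
Proof.
elim: k f => [f [cf _]|k IH f [cf H]] //.
by split=> // v; have [dv Cv] := H v; split=> //; exact: IH.
Qed.

Lemma Ck_ext V W k (D : set V) (f g : V -> W) : open D ->
  (forall x, D x -> f x = g x) -> Ck k D f -> Ck k D g.
Proof.
move=> oD; elim: k f g => [f g fg [cf _]|k IH f g fg [cf H]]; split=> //.
- by move=> x Dx; apply: near_continuous (cf x Dx); exact: near_open oD Dx fg.
- by move=> x Dx; apply: near_continuous (cf x Dx); exact: near_open oD Dx fg.
move=> v; have [dv Cv] := H v; split=> [x Dx|].
  by apply: near_eq_derivable (dv x Dx); exact: near_open oD Dx fg.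
apply: IH Cv => x Dx; apply: near_eq_derive; exact: near_open oD Dx fg.
Qed.

(** The induction step behind all closure properties below: a formula for the derivatives is
    supplied and only their regularity remains. Continuity of [f] is asked separately because
    directional derivatives do not imply it. *)
Lemma Ck_S V W k (D : set V) (f : V -> W) (df : V -> V -> W) : open D ->
  (forall x, D x -> {for x, continuous f}) ->
  (forall v x, D x -> is_derive x v f (df v x)) ->
  (forall v, Ck k D (df v)) -> Ck k.+1 D f.
Proof.
move=> oD cf Df Cdf; split=> // v; split=> [x Dx|]; first by case: (Df v x Dx).
by apply: Ck_ext (Cdf v) => // x Dx; case: (Df v x Dx).
Qed.

Lemma Ck_is_derive V W k (D : set V) (f : V -> W) v x :
  Ck k.+1 D f -> D x -> is_derive x v f ('D_v f x).
Proof. by move=> [_ /(_ v)[df _]] Dx; apply/derivableP/df. Qed.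

Lemma Ck_derive V W k (D : set V) (f : V -> W) v : Ck k.+1 D f -> Ck k D ('D_v f).
Proof. by move=> [_ /(_ v)[]]. Qed.

Lemma Ck_cst V W k (D : set V) (a : W) : open D -> Ck k D (fun=> a).
Proof.
move=> oD; elim: k a => [a|k IH a]; first by split=> // x _; exact: cvg_cst.
apply: (@Ck_S _ _ _ _ _ (fun _ _ => 0)) => // x Dx; exact: cvg_cst.
Qed.

Lemma CkD V W k (D : set V) (f g : V -> W) : open D ->
  Ck k D f -> Ck k D g -> Ck k D (fun x => f x + g x).
Proof.
move=> oD; elim: k f g => [f g [cf _] [cg _]|k IH f g Cf Cg].
  by split=> // x Dx; apply: cvgD; [exact: cf|exact: cg].
apply: (@Ck_S _ _ _ _ _ (fun v x => 'D_v f x + 'D_v g x)) => //.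
- by move=> x Dx; apply: cvgD; [exact: (Ck_continuous Cf)|exact: (Ck_continuous Cg)].
- move=> v x Dx; apply: is_deriveD; [exact: (Ck_is_derive _ Cf)|exact:
    (Ck_is_derive _ Cg)].
- by move=> v; apply: IH; exact: Ck_derive.
Qed.

Lemma CkM V k (D : set V) (f g : V -> R) : open D ->
  Ck k D f -> Ck k D g -> Ck k D (fun x => f x * g x).
Proof.
move=> oD; elim: k f g => [f g [cf _] [cg _]|k IH f g Cf Cg].
  by split=> // x Dx; apply: cvgM; [exact: cf|exact: cg].
apply: (@Ck_S _ _ _ _ _ (fun v x => f x * 'D_v g x + g x * 'D_v f x)) => //.
- by move=> x Dx; apply: cvgM; [exact: (Ck_continuous Cf)|exact: (Ck_continuous Cg)].
- move=> v x Dx; apply: (@is_deriveM _ _ f g); [exact: (Ck_is_derive _ Cf)|exact: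
    (Ck_is_derive _ Cg)].
- by move=> v; apply: CkD => //; apply: IH; solve [exact: Ck_derive | exact: CkW].
Qed.

Lemma CkZ V k (D : set V) (c : R) (f : V -> R) : open D ->
  Ck k D f -> Ck k D (fun x => c * f x).
Proof. by move=> oD; apply: CkM => //; exact: Ck_cst. Qed.

Lemma CkV V k (D : set V) (f : V -> R) : open D -> (forall x, D x -> f x != 0) ->
  Ck k D f -> Ck k D (fun x => (f x)^-1).
Proof.
move=> oD f0; elim: k => [[cf _]|k IH Cf].
  by split=> // x Dx; apply: cvgV; [exact: f0|exact: cf].
apply: (@Ck_S _ _ _ _ _ (fun v x => (-1) * ((f x)^-1 * (f x)^-1 * 'D_v f x))) => //.
- by move=> x Dx; apply: cvgV; [exact: f0|exact: (Ck_continuous Cf)].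
- move=> v x Dx; have dfx := Ck_is_derive v Cf Dx.
  have -> : -1 * ((f x)^-1 * (f x)^-1 * 'D_v f x) = - (f x) ^-2 *: 'D_v f x.
    by rewrite /GRing.scale/= mulN1r mulNr expr2 invfM.
  rewrite -deriveV //; last exact: f0.
  by apply: derivableP; apply: derivableV => //; exact: f0.
- move=> v; apply: CkZ => //; apply: CkM => //; last exact: Ck_derive.
  by have Ci := IH (CkW Cf); apply: CkM.
Qed.

(** For [A] affine with linear part [L], the difference quotient of [f \o A] at [x] along [v] is
    literally that of [f] at [A x] along [L v]. Directional derivatives thus transfer without a
    chain rule for differentials. *)
Lemma is_derive_affine V V' W (A L : V -> V') (f : V' -> W) v x df :
  (forall h v x, A (h *: v + x) = h *: L v + A x) ->
  is_derive (A x) (L v) f df -> is_derive x v (f \o A) df.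
Proof.
move=> AL [dfe fdf].
have E : (fun h => h^-1 *: (((f \o A) \o shift x) (h *: v) - (f \o A) x)) =
    (fun h => h^-1 *: ((f \o shift (A x)) (h *: L v) - f (A x))).
  by apply/funext => h /=; rewrite AL.
by split; rewrite /derivable /derive E.
Qed.

Lemma Ck_affine V V' W (A L : V -> V') k (D : set V') (D' : set V) (f : V' -> W) :
  open D' -> (forall x, D' x -> D (A x)) ->
  (forall h v x, A (h *: v + x) = h *: L v + A x) -> continuous A ->
  Ck k D f -> Ck k D' (f \o A).
Proof.
move=> oD' DA AL cA; elim: k f => [f [cf _]|k IH f Cf].
  by split=> // x Dx; apply: continuous_comp; [exact: cA|exact/cf/DA].
apply: (@Ck_S _ _ _ _ _ (fun v => 'D_(L v) f \o A)) => //.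
- by move=> x Dx; apply: continuous_comp; [exact: cA|exact/(Ck_continuous Cf)/DA].
- by move=> v x Dx; apply: (is_derive_affine AL); exact/(Ck_is_derive _ Cf)/DA.
- by move=> v; apply: IH; exact: Ck_derive.
Qed.

(** Linearity enters only through the difference quotients, whence the single identity asked of [P];
    continuity then lets [P] pass to the limit. *)
Lemma is_derive_linear V W W' (P : W -> W') (f : V -> W) v x df :
  (forall a y z, P (a *: (y - z)) = a *: (P y - P z)) -> continuous P ->
  is_derive x v f df -> is_derive x v (P \o f) (P df).
Proof.
move=> PL cP [dfe fdf].
have E : (fun h => h^-1 *: (((P \o f) \o shift x) (h *: v) - (P \o f) x)) =
    P \o (fun h => h^-1 *: ((f \o shift x) (h *: v) - f x)).
  by apply/funext => h /=; rewrite PL.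
have cvgP : (fun h => h^-1 *: (((P \o f) \o shift x) (h *: v) - (P \o f) x)) @ 0^' -->
    P df.
  by rewrite E -fdf; apply: cvg_comp; [exact: dfe|exact: cP].
by split; [apply/cvg_ex; exists (P df)|exact/cvg_lim].
Qed.

Lemma Ck_linear V W W' (P : W -> W') k (D : set V) (f : V -> W) : open D ->
  (forall a y z, P (a *: (y - z)) = a *: (P y - P z)) -> continuous P ->
  Ck k D f -> Ck k D (P \o f).
Proof.
move=> oD PL cP; elim: k f => [f [cf _]|k IH f Cf].
  by split=> // x Dx; apply: continuous_comp; [exact: cf|exact: cP].
apply: (@Ck_S _ _ _ _ _ (fun v => P \o 'D_v f)) => //.
- by move=> x Dx; apply: continuous_comp; [exact: (Ck_continuous Cf)|exact: cP].
- by move=> v x Dx; apply: is_derive_linear => //; exact: (Ck_is_derive _ Cf).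
- by move=> v; apply: IH; exact: Ck_derive.
Qed.

Lemma fst_continuous (T U : topologicalType) : continuous (@fst T U).
Proof. by move=> p; exact: cvg_fst. Qed.

Lemma snd_continuous (T U : topologicalType) : continuous (@snd T U).
Proof. by move=> p; exact: cvg_snd. Qed.

Lemma Ck_fst V W W' k (D : set V) (f : V -> (W * W')%type) : open D ->
  Ck k D f -> Ck k D (fun x => (f x).1).
Proof. by move=> oD Cf; apply: (@Ck_linear _ _ _ fst) => //; exact: fst_continuous. Qed.

Lemma Ck_snd V W W' k (D : set V) (f : V -> (W * W')%type) : open D ->
  Ck k D f -> Ck k D (fun x => (f x).2).
Proof. by move=> oD Cf; apply: (@Ck_linear _ _ _ snd) => //; exact: snd_continuous. Qed.

End CkCalculus.

(** * Smooth plateau functions *)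

Section FlatFunction.
Variable R : realType.

(** Each monomial satisfies y^i <= i! e^y, by the exponential series. *)
Lemma poly_le_expR (P : {poly R}) :
  exists C, forall y, 0 <= y -> `|P.[y]| <= C * expR y.
Proof.
exists (\sum_(i < size P) `|P`_i| * (i`!)%:R) => y y0.
rewrite horner_coef mulr_suml (le_trans (ler_norm_sum _ _ _)) // ler_sum // => i _.
rewrite normrM normrX (ger0_norm y0) -mulrA ler_wpM2l //.
case: (nat_of_ord i) => [|n]; first by rewrite expr0 mul1r -(expR0 R) ler_expR.
have := expR_ge1Dxn n y0; rewrite -ler_pdivrMl ?ltr0n ?fact_gt0 // mulrC => h.
by apply: le_trans h; rewrite lerDr.
Qed.

(* The class of these functions is stable by derivation. *)
Definition flat (P : {poly R}) (x : R) : R :=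
  if 0 < x then P.[x^-1] * expR (- x^-1) else 0.

(** With y = 1/x, so that y' = - y^2, the product P(y) e^(-y) has derivative y^2 (P - P')(y)
    e^(-y). *)
Lemma is_derive1_flat (P : {poly R}) (x : R) :
  is_derive x 1 (flat P) (flat ('X^2 * (P - P^`())) x).
Proof.
have [x0|x0|->] := ltgtP x 0.
- rewrite [flat _ x]/flat ltNge (ltW x0) /=.
  apply: (@near_eq_is_derive _ _ _ (cst 0)).
  apply: (near_open (@open_lt R 0) x0) => y y0.
  by rewrite /flat ltNge (ltW y0).
- have xn0 : x != 0 by rewrite gt_eqF.
  apply: (@near_eq_is_derive _ _ _
      (fun x => (horner P \o GRing.inv) x * (expR \o (-%R \o GRing.inv)) x)).
    by apply: (near_open (@open_gt R 0) x0) => y /= y0; rewrite /flat y0.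
  have di : is_derive x 1 (@GRing.inv R) (- x ^- 2).
    have H := @is_deriveV R id x 1 1 xn0 (is_derive_id _ _).
    by apply: is_derive_eq; rewrite /GRing.scale/= mulr1.
  rewrite [flat _ x]/flat x0.
  apply: is_derive_eq.
  rewrite /GRing.scale /= hornerM hornerXn hornerD hornerN exprVn; ring.
- rewrite [flat _ 0]/flat ltxx.
  (* The factor 'X^2 buys a spare power of h: the difference quotient at 0 is h times the value of
     y^2 P(y) e^(-y) at y = 1/h, and the latter is bounded by [C]. *)
  have [C HC] := poly_le_expR ('X^2 * P).
  have lim0 : (fun h => h^-1 *: ((flat P \o shift 0) (h *:
    1) - flat P 0)) @ 0^' --> (0 : R).
    apply/cvgr0Pnorm_le => e e0 /=.
    near=> h.
    rewrite /= /GRing.scale /= mulr1 addr0 {2}/flat ltxx subr0 /flat.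
    have [h0|h0] := ltP 0 h; last by rewrite mulr0 normr0 ltW.
    have hi : 0 <= h^-1 by rewrite invr_ge0 ltW.
    have := HC _ hi; rewrite hornerM hornerXn => H.
    have -> : h^-1 * (P.[h^-1] * expR (- h^-1)) =
        h * (h^-1 ^+ 2 * P.[h^-1] * expR (- h^-1)).
      by field; rewrite gt_eqF.
    rewrite normrM (normrM _ (expR _)) (ger0_norm (expR_ge0 _)).
    apply: (@le_trans _ _ (`|h| * C)).
      rewrite ler_wpM2l // expRN ler_pdivrMr ?expR_gt0 //.
    apply: (@le_trans _ _ (`|h| * `|C|)); first by rewrite ler_wpM2l // ler_norm.
    have C1 : 0 < `|C| + 1 by rewrite ltr_wpDl.
    apply: (@le_trans _ _ (`|h| * (`|C| + 1))); first by rewrite ler_wpM2l // lerDl.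
    rewrite -ler_pdivlMr // ltW //.
    near: h; apply: dnbhs0_lt; exact: divr_gt0.
  split; first by apply/cvg_ex; exists 0.
  exact/cvg_lim.
Unshelve. all: by end_near. Qed.

(** [Ck] quantifies over all directions; on the line, derivability along 1 is differentiability, and
    linearity of the differential gives the others. *)
Lemma is_derive_real (W : normedModType R) (f : R -> W) (x v : R) (d : W) :
  is_derive x 1 f d -> is_derive x v f (v *: d).
Proof.
move=> [df <-]; have Df := (derivable1_diffP _ _).1 df.
split; first exact: diff_derivable.
by rewrite !deriveE // -linearZ /= /GRing.scale /= mulr1.
Qed.

Lemma smooth_flat P : smooth (flat P).
Proof.
have cf Q x : {for x, continuous (flat Q)}.
  by apply/differentiable_continuous/derivable1_diffP; case: (is_derive1_flat Q x).
move=> k; elim: k P => [P|k IH P]; first by split.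
apply: (@Ck_S R R R k setT (flat P) (fun v x : R => v * flat ('X^2 * (P - P^`())) x)).
- exact: openT.
- by move=> x _; exact: cf.
- by move=> v x _; apply: is_derive_real; exact: is_derive1_flat.
- by move=> v; apply: CkZ (IH _); exact: openT.
Qed.

(** The classical transition function from 0 (for x <= 0) to 1 (for x >= 1), built on e^(-1/x),
    which is [flat 1]. The denominator is positive since x and 1 - x are never both nonpositive. *)
Definition smooth_step (x : R) : R := flat 1 x / (flat 1 x + flat 1 (1 - x)).

Lemma flat_ge0 x : 0 <= flat 1 x.
Proof. by rewrite /flat; case: ifP => // _; rewrite hornerC mul1r expR_ge0. Qed.

Lemma flat_gt0 x : 0 < x -> 0 < flat 1 x.
Proof. by rewrite /flat => ->; rewrite hornerC mul1r expR_gt0. Qed.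

Lemma flat_le0 x : x <= 0 -> flat 1 x = 0.
Proof. by rewrite /flat ltNge => ->. Qed.

Lemma smooth_step_denom x : 0 < flat 1 x + flat 1 (1 - x).
Proof.
have [x0|x0] := ltP 0 x; first by rewrite ltr_pwDl ?flat_gt0 ?flat_ge0.
by rewrite ltr_wpDl ?flat_ge0 ?flat_gt0 // subr_gt0 (le_lt_trans x0).
Qed.

Lemma smooth_step_ge0 x : 0 <= smooth_step x.
Proof. by rewrite divr_ge0 ?flat_ge0 // ltW ?smooth_step_denom. Qed.

Lemma smooth_step_le0 x : x <= 0 -> smooth_step x = 0.
Proof. by move=> x0; rewrite /smooth_step flat_le0 // mul0r. Qed.

Lemma smooth_step_ge1 x : 1 <= x -> smooth_step x = 1.
Proof.
move=> x1; have := smooth_step_denom x; rewrite /smooth_step (@flat_le0 (1 - x)).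
  by rewrite addr0 => x0; rewrite divff // gt_eqF.
by rewrite subr_le0.
Qed.

Lemma smooth_affine (f : R -> R) (a b : R) : smooth f ->
  smooth (fun x => f (a + b * x)).
Proof.
move=> sf k; apply: (@Ck_affine _ _ _ _ (fun x => a + b * x) (fun x => b * x) _ setT).
- exact: openT.
- by [].
- by move=> h v x; rewrite /GRing.scale /=; ring.
- by move=> x; apply: cvgD; [exact: cvg_cst|exact: mulrl_continuous].
- exact: sf.
Qed.

Lemma smooth_smooth_step : smooth smooth_step.
Proof.
move=> k; have oT := @openT R.
have C1 := smooth_flat 1 k.
have C2 : Ck k setT (fun x : R => flat 1 (1 - x)).
  apply: (Ck_ext oT _ (smooth_affine 1 (-1) (smooth_flat 1) k)) => x _.
  by rewrite mulN1r.
apply: CkM => //; apply: CkV => //; last exact: CkD.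
by move=> x _; rewrite gt_eqF // smooth_step_denom.
Qed.

Definition plateau (r x : R) : R := smooth_step (r + 1 - x) * smooth_step (r + 1 + x).

Lemma plateau_ge0 r x : 0 <= plateau r x.
Proof. by rewrite mulr_ge0 ?smooth_step_ge0. Qed.

Lemma plateau1 r x : `|x| <= r -> plateau r x = 1.
Proof.
rewrite ler_norml => /andP[x1 x2].
by rewrite /plateau !smooth_step_ge1 ?mulr1 //; lra.
Qed.

Lemma plateau0 r x : r + 1 <= `|x| -> plateau r x = 0.
Proof.
rewrite ler_normr => /orP[] x1; rewrite /plateau.
  by rewrite smooth_step_le0 ?mul0r //; lra.
by rewrite mulrC smooth_step_le0 ?mul0r //; lra.
Qed.

Lemma smooth_plateau r : smooth (plateau r).
Proof.
move=> k; have oT := @openT R; apply: CkM => //.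
  apply: (Ck_ext oT _ (smooth_affine (r + 1) (-1) smooth_smooth_step k)) => x _.
  by rewrite mulN1r.
apply: (Ck_ext oT _ (smooth_affine (r + 1) 1 smooth_smooth_step k)) => x _.
by rewrite mul1r.
Qed.

End FlatFunction.

(** * Test functions *)

Section TestFunctions.
Variable R : realType.
Implicit Types V : normedModType R.

Lemma supp_closed V (f : V -> R) : closed (supp f).
Proof. exact: closed_closure. Qed.

Lemma in_supp V (f : V -> R) x : f x != 0 -> supp f x.
Proof. by move=> fx; apply: subset_closure. Qed.

Lemma notin_supp V (f : V -> R) x : ~ supp f x -> f x = 0.
Proof. by move=> nfx; apply/eqP; apply: contra_notT nfx; exact: in_supp. Qed.

Lemma supp_sub V (f : V -> R) (K : set V) :
  closed K -> (forall x, f x != 0 -> K x) -> supp f `<=` K.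
Proof. by move=> cK fK; rewrite (closure_id K).1 //; exact: closureS. Qed.

Lemma near_notin_supp V (f : V -> R) x : ~ supp f x -> \near x, f x = 0.
Proof.
move=> nfx; have oC := closed_openC (@supp_closed _ f).
by apply: (near_open oC nfx) => y /notin_supp.
Qed.

Lemma derive_notin_supp V (f : V -> R) v x : ~ supp f x -> 'D_v f x = 0.
Proof.
move=> nfx; rewrite -(derive_cst (0 : R) x v); apply: near_eq_derive.
exact: near_notin_supp.
Qed.

Lemma supp_derive V (f : V -> R) v : supp ('D_v f) `<=` supp f.
Proof.
apply: supp_sub; first exact: supp_closed.
by move=> x; apply: contra_neqP; exact: derive_notin_supp.
Qed.

Lemma smooth_derive V (f : V -> R) v : smooth f -> smooth ('D_v f).
Proof. by move=> sf k; exact: Ck_derive. Qed.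

Lemma smooth_continuous V (f : V -> R) : smooth f -> continuous f.
Proof. by move=> sf x; exact: (Ck_continuous (sf 0%N)). Qed.

Lemma smooth_is_derive V (f : V -> R) v x : smooth f -> is_derive x v f ('D_v f x).
Proof. by move=> sf; exact: (Ck_is_derive v (sf 1%N)). Qed.

Lemma test_function_sub V (D : set V) (f g : V -> R) : test_function D f ->
  smooth g -> (forall x, g x != 0 -> supp f x) -> test_function D g.
Proof.
move=> [_ cf sf] sg gf; have gsf := supp_sub (@supp_closed _ f) gf.
split=> //; last exact: subset_trans sf.
exact: subclosed_compact (@supp_closed _ g) cf gsf.
Qed.

Lemma test_function_derive V (D : set V) (f : V -> R) v :
  test_function D f -> test_function D ('D_v f).
Proof.
move=> tf; apply: (test_function_sub tf); first by apply: smooth_derive; case: tf.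
by move=> x; apply: contra_neqP; exact: derive_notin_supp.
Qed.

Lemma smoothM V (f g : V -> R) : smooth f -> smooth g -> smooth (fun x => f x * g x).
Proof. by move=> sf sg k; apply: CkM => //; exact: openT. Qed.

Lemma smooth_comp_fst (V W : normedModType R) (f : V -> R) :
  smooth f -> smooth (fun x : (V * W)%type => f x.1).
Proof.
move=> sf k; apply: (@Ck_affine _ _ _ _ fst fst _ setT) => //; first exact: openT.
exact: fst_continuous.
Qed.

Lemma smooth_comp_snd (V W : normedModType R) (f : W -> R) :
  smooth f -> smooth (fun x : (V * W)%type => f x.2).
Proof.
move=> sf k; apply: (@Ck_affine _ _ _ _ snd snd _ setT) => //; first exact: openT.
exact: snd_continuous.
Qed.

Lemma smooth_id : smooth (fun x : R => x).
Proof.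
have cid : forall x : R, setT x -> {for x, continuous (fun x : R => x)}.
  by move=> x _; exact: cvg_id.
case=> [|k]; first by split.
apply: (@Ck_S R R R k setT (fun x : R => x) (fun v x : R => v));
  [exact: openT|exact: cid|].
by move=> v; apply: Ck_cst; exact: openT.
Qed.

Lemma test_function_tensor (V W : normedModType R) (D : set V) (E : set W)
    (f : V -> R) (g : W -> R) :
  test_function D f -> test_function E g ->
  test_function (D `*` E) (fun x : (V * W)%type => f x.1 * g x.2).
Proof.
move=> [sf cf fD] [sg cg gE].
have cK := compact_setX cf cg.
have sK : supp (fun x : (V * W)%type => f x.1 * g x.2) `<=` supp f `*` supp g.
  apply: supp_sub.
    by apply: closedI; apply: preimage_closed (@supp_closed _ _) => x _;
      [exact: fst_continuous|exact: snd_continuous].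
  by move=> x; rewrite mulf_eq0 negb_or => /andP[/in_supp ? /in_supp ?].
split.
- by apply: smoothM; [exact: smooth_comp_fst|exact: smooth_comp_snd].
- exact: subclosed_compact (@supp_closed _ _) cK sK.
- by apply: (subset_trans sK) => x [/fD ? /gE].
Qed.

End TestFunctions.

(** * Integration of compactly supported functions *)

Section Integration.
Context d (T : measurableType d) (R : realType).

Lemma bounded_support_integrable (mu : {measure set T -> \bar R}) (A : set T)
    (f : T -> R) (M : R) :
  measurable A -> (mu A < +oo)%E -> measurable_fun setT f ->
  (forall x, `|f x| <= M) -> (forall x, ~ A x -> f x = 0) ->
  mu.-integrable setT (EFin \o f).
Proof.
move=> mA Afin mf bf f0.
have -> : EFin \o f = (EFin \o f) \_ A.
  apply/funext => x; rewrite patchE; case: ifPn => //; rewrite notin_setE => nAx.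
  by rewrite /= f0.
apply/(integrable_mkcond _ mA); apply: measurable_bounded_integrable => //.
  exact: measurable_funTS.
exists M; split; first exact: num_real.
by move=> y My x _; apply: (le_trans (bf x)); exact: ltW.
Qed.

End Integration.

Section FiniteProduct.
Context d1 d2 (T1 : measurableType d1) (T2 : measurableType d2) (R : realType).
Variables (m1 : {sigma_finite_measure set T1 -> \bar R})
          (m2 : {sigma_finite_measure set T2 -> \bar R}).

Lemma sf_prodX A B : measurable A -> measurable B ->
  sf_prod m1 m2 (A `*` B) = (m1 A * m2 B)%E.
Proof. exact: product_measure1E. Qed.

Lemma sf_prod_lty A B : measurable A -> measurable B ->
  (m1 A < +oo)%E -> (m2 B < +oo)%E -> (sf_prod m1 m2 (A `*` B) < +oo)%E.
Proof.
by move=> mA mB A1 B2; rewrite sf_prodX // lte_mul_pinfty // ge0_fin_numE.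
Qed.

End FiniteProduct.

Section FubiniReal.
Context d1 d2 (T1 : measurableType d1) (T2 : measurableType d2) (R : realType).
Variables (m1 : {sigma_finite_measure set T1 -> \bar R})
          (m2 : {sigma_finite_measure set T2 -> \bar R}).
Variable f : T1 * T2 -> R.
Hypothesis fi : (sf_prod m1 m2).-integrable setT (EFin \o f).

(** Integrability on the product makes the inner integral finite only almost everywhere.
    Integrability of every slice makes [fine] faithful at each point, so the iterated real integral
    is the extended one. *)
Lemma Rintegral_fubini1 : (forall x, m2.-integrable setT (fun y => (f (x, y))%:E)) ->
  \int[sf_prod m1 m2]_z f z = \int[m1]_x \int[m2]_y f (x, y).
Proof.
move=> fx; rewrite /Rintegral -(@integral12_prod_meas1 _ _ _ _ _ m1 m2 (EFin \o f) fi).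
congr fine; apply: eq_integral => x _ /=; rewrite fineK //.
exact: integrable_fin_num.
Qed.

Lemma Rintegral_fubini2 : (forall y, m1.-integrable setT (fun x => (f (x, y))%:E)) ->
  \int[sf_prod m1 m2]_z f z = \int[m2]_y \int[m1]_x f (x, y).
Proof.
move=> fx; rewrite /Rintegral -(@integral21_prod_meas1 _ _ _ _ _ m1 m2 (EFin \o f) fi).
congr fine; apply: eq_integral => x _ /=; rewrite fineK //.
exact: integrable_fin_num.
Qed.

End FubiniReal.

Section Boxes.
Variable R : realType.
Local Notation mR := (measurableTypeR R).
Local Notation leb1 := (@lebesgue_measure R).

Definition box1 (r : R) : set R := `[- r, r].
Definition box2 r : set (R * R) := box1 r `*` box1 r.
Definition box3 r : set (R * (R * R)) := box1 r `*` box2 r.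

Lemma box1P r x : box1 r x <-> `|x| <= r.
Proof. by rewrite /box1 /= in_itv /= ler_norml. Qed.

Lemma box2P r (x : velocity R) : box2 r x <-> `|x| <= r.
Proof.
rewrite /box2 /setX /= !box1P prod_normE ge_max.
by split=> [[a b]|/andP[a b]]; [apply/andP|].
Qed.

Lemma box3P r (x : spacetime R) : box3 r x <-> `|x| <= r.
Proof.
have -> : (`|x| <= r) = (`|x.1| <= r) && (`|x.2| <= r) by rewrite [LHS]ge_max.
rewrite /box3 /setX /= box1P box2P.
by split=> [[a b]|/andP[a b]]; [apply/andP|].
Qed.

Lemma box2_compact r : compact (box2 r).
Proof. by apply: compact_setX; exact: segment_compact. Qed.

Lemma box3_compact r : compact (box3 r).
Proof. by apply: compact_setX; [exact: segment_compact|exact: box2_compact]. Qed.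

Lemma measurable_box2 r : measurable (box2 r : set (mR * mR)).
Proof. by apply: measurableX; exact: measurable_itv. Qed.

Lemma measurable_box3 r : measurable (box3 r : set (mR * (mR * mR))).
Proof. by apply: measurableX; [exact: measurable_itv|exact: measurable_box2]. Qed.

Lemma box1_fin r : (leb1 (box1 r) < +oo)%E.
Proof. by rewrite /box1 lebesgue_measure_itv /=; case: ifP => // _; rewrite ltry. Qed.

Lemma box2_fin r : (leb2 R (box2 r) < +oo)%E.
Proof.
by apply: sf_prod_lty; [exact: measurable_itv|exact: measurable_itv|exact:
  box1_fin|exact: box1_fin].
Qed.

Lemma box3_fin r : (leb3 R (box3 r) < +oo)%E.
Proof.
apply: sf_prod_lty; [exact: measurable_itv|exact: measurable_box2|exact: box1_fin|].
exact: box2_fin.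
Qed.

Lemma box5_fin r r' : (leb5 R (box3 r `*` box2 r') < +oo)%E.
Proof.
apply: sf_prod_lty; [exact: measurable_box3|exact: measurable_box2|exact: box3_fin|].
exact: box2_fin.
Qed.

End Boxes.

Section CompactlySupported.
Variable R : realType.
Local Notation mR := (measurableTypeR R).
Local Notation leb1 := (@lebesgue_measure R).
Implicit Types V : normedModType R.

(** Vanishing outside a ball stands for compact support: it is meaningful in any normed space and
    passes at once to slices, as iterated integration requires. *)
Definition Cc V (f : V -> R) :=
  continuous f /\ exists r, forall x, r < `|x| -> f x = 0.

Lemma bounded_on_compact (T : topologicalType) (K : set T) (f : T -> R) :
  compact K -> (forall x, K x -> {for x, continuous f}) ->
  exists M, forall x, K x -> `|f x| <= M.
Proof.
move=> cK cf.
have /compact_bounded [M [_ HM]] : compact (f @` K).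
  apply: continuous_compact => //; apply: continuous_in_subspaceT => x.
  by rewrite inE => /cf.
exists (`|M| + 1) => x Kx; apply: (HM (`|M| + 1)); last by exists x.
by rewrite (le_lt_trans (ler_norm M)) // ltrDl.
Qed.

Lemma Cc_bounded V (f : V -> R) (B : R -> set V) :
  (forall r, compact (B r)) -> (forall r x, B r x <-> `|x| <= r) -> Cc f ->
  exists r M, (forall x, `|f x| <= M) /\ (forall x, ~ B r x -> f x = 0).
Proof.
move=> cB BP [cf [r f0]]; exists r.
have [M HM] := bounded_on_compact (cB r) (fun x _ => cf x).
exists `|M|; split=> x; last by rewrite BP => /negP; rewrite -ltNge; exact: f0.
have [xr|/f0 ->] := leP `|x| r; last by rewrite normr0.
by apply: (le_trans (HM x _)); [exact/BP|exact: ler_norm].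
Qed.

Lemma Cc_integrable1 (f : R -> R) : Cc f -> leb1.-integrable setT (EFin \o f).
Proof.
move=> Cf; have [r [M [fM f0]]] := Cc_bounded (fun r =>
  @segment_compact R (- r) r) (@box1P R) Cf.
apply: (@bounded_support_integrable _ mR R leb1 (box1 r) f M) => //;
  first exact: measurable_itv.
  exact: box1_fin.
by apply: continuous_measurable_fun; case: Cf.
Qed.

Lemma Cc_integrable2 (f : velocity R -> R) : Cc f ->
  (leb2 R).-integrable setT (EFin \o f).
Proof.
move=> Cf; have [r [M [fM f0]]] := Cc_bounded (@box2_compact R) (@box2P R) Cf.
apply: (@bounded_support_integrable _ (mR * mR)%type R (leb2 R) (box2 r) f M) => //.
- exact: measurable_box2.
- exact: box2_fin.
by apply: continuous_measurable2; [exact: openT|case: Cf => cf _ x _; exact: cf].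
Qed.

Lemma Cc_integrable3 (f : spacetime R -> R) : Cc f ->
  (leb3 R).-integrable setT (EFin \o f).
Proof.
move=> Cf; have [r [M [fM f0]]] := Cc_bounded (@box3_compact R) (@box3P R) Cf.
apply: (@bounded_support_integrable _ (mR * (mR * mR))%type R (leb3 R) (box3 r) f M)
  => //.
- exact: measurable_box3.
- exact: box3_fin.
by apply: continuous_measurable3; [exact: openT|case: Cf => cf _ x _; exact: cf].
Qed.

Lemma Cc_pair1 (V W : normedModType R) (f : (V * W)%type -> R) x :
  Cc f -> Cc (fun y => f (x, y)).
Proof.
move=> [cf [r f0]]; split.
  move=> y; apply: continuous_comp; last exact: cf.
  by apply: cvg_pair => /=; [exact: cvg_cst|exact: cvg_id].
exists r => y ry; apply: f0; apply: (lt_le_trans ry).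
by rewrite [leRHS]prod_normE le_max lexx orbT.
Qed.

Lemma Cc_pair2 (V W : normedModType R) (f : (V * W)%type -> R) y :
  Cc f -> Cc (fun x => f (x, y)).
Proof.
move=> [cf [r f0]]; split.
  move=> x; apply: continuous_comp; last exact: cf.
  by apply: cvg_pair => /=; [exact: cvg_id|exact: cvg_cst].
exists r => x rx; apply: f0; apply: (lt_le_trans rx).
by rewrite [leRHS]prod_normE le_max lexx.
Qed.

Lemma Rintegral_derive1 (f df : R -> R) : Cc f -> Cc df ->
  (forall x : R, is_derive x 1 f (df x)) -> \int[leb1]_x df x = 0.
Proof.
move=> [cf [r f0]] [cdf [r' df0]] Df.
(* The radius [s] exceeds both [r] and [r'], so [df] vanishes off the segment and [f] vanishes at
   both endpoints. *)
pose s : R := `|r| + `|r'| + 1.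
have s0 : 0 < s by rewrite /s ltr_wpDl // addr_ge0.
have rs (x : R) : s <= `|x| -> r < `|x| /\ r' < `|x|.
  move=> sx; have := ler_norm r; have := ler_norm r'.
  have := normr_ge0 r; have := normr_ge0 r'; rewrite /s in sx; split; lra.
have -> : \int[leb1]_x df x = \int[leb1]_(x in `[- s, s]) df x.
  rewrite [RHS]Rintegral_mkcond; congr Rintegral; apply/funext => x.
  rewrite patchE; case: ifPn => //; rewrite notin_setE /= in_itv /= -ler_norml.
  by move/negP; rewrite -ltNge => /ltW/rs[_ /df0].
have ss : - s < s by lra.
rewrite /Rintegral (continuous_FTC2 ss (F := f)).
- have sP : s <= `|s| by rewrite ger0_norm // ltW.
  have sN : s <= `|- s| by rewrite normrN.
  by rewrite (f0 s (rs _ sP).1) (f0 (- s) (rs _ sN).1) /= subrr.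
- exact: continuous_subspaceT.
- split=> [x _||]; first by case: (Df x).
  + exact/cvg_at_right_filter/cf.
  + exact/cvg_at_left_filter/cf.
- by move=> x _; rewrite derive1E; case: (Df x).
Qed.

Lemma is_derive_pair1 (V W U : normedModType R) (f : (V * W)%type -> U) x y (v : V) d :
  is_derive (x, y) (v, 0) f d -> is_derive x v (fun x => f (x, y)) d.
Proof.
apply: (@is_derive_affine _ _ _ _ (fun x => (x, y)) (fun v => (v, 0))) => h v' x'.
by congr pair; rewrite /= scaler0 add0r.
Qed.

Lemma is_derive_pair2 (V W U : normedModType R) (f : (V * W)%type -> U) x y (v : W) d :
  is_derive (x, y) (0, v) f d -> is_derive y v (fun y => f (x, y)) d.
Proof.
apply: (@is_derive_affine _ _ _ _ (fun y => (x, y)) (fun v => (0, v))) => h v' x'.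
by congr pair; rewrite /= scaler0 add0r.
Qed.

Lemma Rintegral_eq0 d (T : measurableType d) (mu : {measure set T -> \bar R})
    (D : set T) (f : T -> R) :
  (forall x, D x -> f x = 0) -> \int[mu]_(x in D) f x = 0.
Proof. by move=> f0; rewrite /Rintegral integral0_eq // => x /f0 ->. Qed.

(** The order of integration is chosen to put the differentiated variable innermost, where the
    one-dimensional statement gives 0. *)
Lemma Rintegral_derive2 (f df : velocity R -> R) (v : velocity R) :
  v = e_xi R \/ v = e_gamma R -> Cc f -> Cc df ->
  (forall x, is_derive x v f (df x)) -> \int[leb2 R]_x df x = 0.
Proof.
move=> ve Cf Cdf Df.
have idf := Cc_integrable2 Cdf.
case: ve => ve; rewrite ve in Df => {v ve}.
  rewrite (Rintegral_fubini2 idf); last by move=> y; apply: Cc_integrable1;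
    exact: Cc_pair2.
  apply: Rintegral_eq0 => y _; apply: (@Rintegral_derive1 (fun x => f (x, y)));
    [exact: Cc_pair2|exact: Cc_pair2|].
  by move=> x; apply: is_derive_pair1; exact: Df.
rewrite (Rintegral_fubini1 idf); last by move=> x; apply: Cc_integrable1;
  exact: Cc_pair1.
apply: Rintegral_eq0 => x _; apply: (@Rintegral_derive1 (fun y => f (x, y)));
  [exact: Cc_pair1|exact: Cc_pair1|].
by move=> y; apply: is_derive_pair2; exact: Df.
Qed.

Lemma Rintegral_derive3 (f df : spacetime R -> R) (v : spacetime R) :
  [\/ v = e_t R, v = e_x R | v = e_y R] -> Cc f -> Cc df ->
  (forall x, is_derive x v f (df x)) -> \int[leb3 R]_x df x = 0.
Proof.
move=> ve Cf Cdf Df.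
have idf := Cc_integrable3 Cdf.
(* The two space directions have the form [(0, w)] and reduce to the planar statement on the slices
   with fixed time. *)
have [ve1|[w [ve1 we]]] : v = e_t R \/ exists w : velocity R, v = (0, w) /\
    (w = e_xi R \/ w = e_gamma R).
- case: ve => ->; [by left|right; exists (e_xi R); split=> //; by left|].
  by right; exists (e_gamma R); split=> //; right.
- rewrite ve1 in Df.
  rewrite (Rintegral_fubini2 idf); last by move=> y; apply: Cc_integrable1;
    exact: Cc_pair2.
  apply: Rintegral_eq0 => y _; apply: (@Rintegral_derive1 (fun x => f (x, y)));
    [exact: Cc_pair2|exact: Cc_pair2|].
  by move=> x; apply: is_derive_pair1; exact: Df.
- rewrite ve1 in Df.
  rewrite (Rintegral_fubini1 idf); last by move=> x; apply: Cc_integrable2;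
    exact: Cc_pair1.
  apply: Rintegral_eq0 => x _; apply: (Rintegral_derive2 (f := fun y => f (x, y)) we);
    [exact: Cc_pair1|exact: Cc_pair1|].
  by move=> y; apply: is_derive_pair2; exact: Df.
Qed.

End CompactlySupported.

(** * Integration by parts against test functions *)

Section IntegrationByParts.
Variable R : realType.
Implicit Types V : normedModType R.

(** Fields are regular on [D] only and arbitrary elsewhere. A point outside [D] is off the closed
    set [supp phi], so the product vanishes in a neighbourhood of it; this is what allows
    integration over the whole space. *)
Lemma continuous_on_mul_supp V (D : set V) (F phi : V -> R) : open D ->
  (forall x, D x -> {for x, continuous F}) -> continuous phi -> supp phi `<=` D ->
  continuous (fun x => F x * phi x).
Proof.
move=> oD cF cphi sD x.
have [Dx|nDx] := pselect (D x); first by apply: cvgM; [exact: cF|exact: cphi].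
have nsx : ~ supp phi x by move/sD.
apply: (@near_continuous _ _ (fun _ : V => 0 : R)); last exact: cvg_cst.
by apply: filterS (near_notin_supp nsx) => y ->; rewrite mulr0.
Qed.

Lemma Cc_mul V (D : set V) (F phi : V -> R) : open D ->
  (forall x, D x -> {for x, continuous F}) -> continuous phi ->
  compact (supp phi) -> supp phi `<=` D -> Cc (fun x => F x * phi x).
Proof.
move=> oD cF cphi csupp sD; split; first exact: (continuous_on_mul_supp oD).
have [M [_ HM]] := compact_bounded csupp.
exists (`|M| + 1) => x Mx; rewrite (@notin_supp _ _ phi) ?mulr0 // => sx.
move: Mx; rewrite ltNge => /negP; apply; apply: HM sx.
by rewrite (le_lt_trans (ler_norm M)) // ltrDl.
Qed.

Lemma test_function_Cc V (D : set V) (F phi : V -> R) : open D ->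
  (forall x, D x -> {for x, continuous F}) -> test_function D phi ->
  Cc (fun x => F x * phi x).
Proof.
by move=> oD cF [sphi cphi sD]; apply: (Cc_mul oD) => //; exact: smooth_continuous.
Qed.

Lemma Rintegral_supp d (T : measurableType d) (mu : {measure set T -> \bar R})
    (D : set T) (f : T -> R) :
  (forall x, ~ D x -> f x = 0) -> \int[mu]_(x in D) f x = \int[mu]_x f x.
Proof.
move=> f0; rewrite Rintegral_mkcond; congr Rintegral; apply/funext => x.
by rewrite patchE; case: ifPn => //; rewrite notin_setE => /f0.
Qed.

Lemma test_function_out V (D : set V) (phi : V -> R) x :
  test_function D phi -> ~ D x -> phi x = 0.
Proof. by move=> [_ _ sD] nDx; apply: notin_supp => /sD. Qed.

Lemma is_derive_mul_test V (D : set V) (F phi : V -> R) v x : open D ->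
  Ck 1 D F -> test_function D phi ->
  is_derive x v (fun x => F x * phi x) ('D_v F x * phi x + F x * 'D_v phi x).
Proof.
move=> oD CF tphi; have [sphi _ sD] := tphi.
have [sx|nsx] := pselect (supp phi x).
  have -> : 'D_v F x * phi x + F x * 'D_v phi x = F x *: 'D_v phi x + phi x *: 'D_v F x.
    by rewrite addrC [X in _ + X]mulrC.
  apply: (@is_deriveM _ _ F phi); last exact: smooth_is_derive.
  by apply: (Ck_is_derive _ CF); exact: sD.
rewrite (derive_notin_supp _ nsx) (notin_supp nsx) !mulr0 addr0.
apply: (@near_eq_is_derive _ _ _ (cst 0)).
by apply: filterS (near_notin_supp nsx) => y ->; rewrite mulr0.
Qed.

Lemma integration_by_parts (D : set (spacetime R)) (F phi : spacetime R -> R) v :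
  [\/ v = e_t R, v = e_x R | v = e_y R] ->
  open D -> Ck 1 D F -> test_function D phi ->
  \int[leb3 R]_(p in D) (F p * 'D_v phi p) = - \int[leb3 R]_(p in D) ('D_v F p * phi p).
Proof.
move=> ve oD CF tphi.
have tdphi := test_function_derive v tphi.
have C1 : Cc (fun x => F x * phi x) by apply: (test_function_Cc oD (Ck_continuous CF)).
have C2 : Cc (fun x => F x * 'D_v phi x) by apply:
  (test_function_Cc oD (Ck_continuous CF)).
have C3 : Cc (fun x => 'D_v F x * phi x).
  by apply: (test_function_Cc oD) => //; exact: (Ck_continuous (Ck_derive v CF)).
rewrite Rintegral_supp; last by move=> x /(test_function_out tdphi) ->; rewrite mulr0.
rewrite [in RHS]Rintegral_supp; last by move=> x /(test_function_out tphi) ->;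
  rewrite mulr0.
apply/eqP; rewrite -addr_eq0 addrC; apply/eqP.
rewrite -RintegralD //; [|exact: Cc_integrable3|exact: Cc_integrable3].
apply: (Rintegral_derive3 ve C1) => [|x]; last exact: is_derive_mul_test tphi.
have [[c2 [r2 z2]] [c3 [r3 z3]]] := (C2, C3); split.
  by move=> x; apply: cvgD; [exact: c3|exact: c2].
exists (Num.max r2 r3) => x; rewrite gt_max => /andP[/z2 -> /z3 ->].
by rewrite addr0.
Qed.

End IntegrationByParts.

(** * Moments of the uniform distribution on a disk *)

Section DiskMoments.
Variable R : realType.
Local Notation mR := (measurableTypeR R).
Local Notation leb1 := (@lebesgue_measure R).

Lemma Rintegral_FTC (f F : R -> R) (a b : R) : a <= b -> continuous f ->
  (forall x : R, is_derive x 1 F (f x)) ->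
  \int[leb1]_(x in `[a, b]) f x = F b - F a.
Proof.
move=> ab cf DF; move: ab; rewrite le_eqVlt => /predU1P[<-|ab].
  by rewrite set_itv1 Rintegral_set1 subrr.
have cF : continuous F.
  by move=> x; apply/differentiable_continuous/derivable1_diffP; case: (DF x).
rewrite /Rintegral (continuous_FTC2 ab (F := F)) //.
- exact: continuous_subspaceT.
- split=> [x _||]; first by case: (DF x).
  + exact/cvg_at_right_filter/cF.
  + exact/cvg_at_left_filter/cF.
- by move=> x _; rewrite derive1E; case: (DF x).
Qed.

Lemma continuous_quadratic (A B C b : R) :
  continuous (fun x => A + B * (x - b) + C * (x - b) ^+ 2).
Proof.
move=> x; apply: cvgD; first apply: cvgD; first exact: cvg_cst.
  by apply: cvgM; [exact: cvg_cst|apply: cvgB; [exact: cvg_id|exact: cvg_cst]].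
apply: cvgM; [exact: cvg_cst|].
by apply: cvgM; (apply: cvgB; [exact: cvg_id|exact: cvg_cst]).
Qed.

Lemma Rintegral_quadratic (A B C b s : R) : 0 <= s ->
  \int[leb1]_(x in `[b - s, b + s]) (A + B * (x - b) + C * (x - b) ^+ 2) =
  2 * s * A + 2 / 3 * s ^+ 3 * C.
Proof.
move=> s0.
pose F x : R := A * (x - b) + B / 2 * (x - b) ^+ 2 + C / 3 * (x - b) ^+ 3.
have DF (x : R) : is_derive x 1 F (A + B * (x - b) + C * (x - b) ^+ 2).
  by rewrite /F; apply: is_derive_eq; rewrite /GRing.scale /=; field.
rewrite (@Rintegral_FTC _ F) //; first by rewrite /F; field.
  by lra.
exact: continuous_quadratic.
Qed.

Lemma Rintegral_trigonometric (c0 c1 c2 : R) :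
  \int[leb1]_(x in `[- (pi / 2), pi / 2])
    ((c0 + c1 * sin x + c2 * sin x ^+ 2) * cos x ^+ 2) = c0 * pi / 2 + c2 * pi / 8.
Proof.
pose F x : R := c0 * (x + sin x * cos x) / 2 - c1 * cos x ^+ 3 / 3
  + c2 * (x - sin x * cos x * (1 - 2 * sin x ^+ 2)) / 8.
have DF (x : R) : is_derive x 1 F ((c0 + c1 * sin x + c2 * sin x ^+ 2) * cos x ^+ 2).
  rewrite /F; apply: is_derive_eq; rewrite /GRing.scale /=.
  (* The derivative of [F] equals the integrand only modulo cos^2 + sin^2 = 1; writing the defect as
     an explicit multiple of 1 - (cos^2 + sin^2) leaves a rational identity. *)
  transitivity ((c0 + c1 * sin x + c2 * sin x ^+ 2) * cos x ^+ 2 +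
    (c0 / 2 + c2 * (1 + 2 * sin x ^+ 2) / 8) * (1 - (cos x ^+ 2 + sin x ^+ 2))).
    by field.
  by rewrite cos2Dsin2 subrr mulr0 addr0.
rewrite (@Rintegral_FTC _ F) //.
- rewrite /F cosN sinN cos_pihalf sin_pihalf; by field.
- have := pi_gt0 R; by lra.
have cs := @continuous_sin R; have cc := @continuous_cos R.
move=> x; apply: cvgM; last by apply: cvgM; exact: cc.
apply: cvgD; first apply: cvgD; first exact: cvg_cst.
  by apply: cvgM; [exact: cvg_cst|exact: cs].
by apply: cvgM; [exact: cvg_cst|apply: cvgM; exact: cs].
Qed.

Lemma continuous_sqrt_disk (a r : R) : continuous (fun x =>
  Num.sqrt (r ^+ 2 - (x - a) ^+ 2)).
Proof.
move=> x; apply: (@continuous_comp _ _ _ (fun x => r ^+ 2 - (x - a) ^+ 2) Num.sqrt).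
  have -> : (fun x => r ^+ 2 - (x - a) ^+ 2) =
      (fun x => r ^+ 2 + 0 * (x - a) + (-1) * (x - a) ^+ 2) by apply/funext => y; ring.
  exact: continuous_quadratic.
exact: sqrt_continuous.
Qed.

(** The weight is the length of the vertical chord of the disk. Under x = a + r sin t the chord
    becomes 2 r cos t, as cos is nonnegative on the range of t, and the Jacobian is r cos t:
    together they give the factor 2 r^2 cos^2 t of the trigonometric integral. *)
Lemma Rintegral_sqrt_quadratic (A B C a r : R) : 0 < r ->
  \int[leb1]_(x in `[a - r, a + r])
    ((A + B * (x - a) + C * (x - a) ^+ 2) * (2 * Num.sqrt (r ^+ 2 - (x - a) ^+ 2))) =
  pi * r ^+ 2 * A + pi * r ^+ 4 / 4 * C.
Proof.
move=> r0; have pi0 := pi_gt0 R.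
pose F x : R := a + r * sin x.
have DF (x : R) : is_derive x 1 F (r * cos x).
  by rewrite /F; apply: is_derive_eq; rewrite /GRing.scale /=; ring.
have dF : derive1 F = (fun x => r * cos x).
  by apply/funext => x; rewrite derive1E; case: (DF x).
have cdF : continuous (fun x => r * cos x).
  by move=> x; apply: cvgM; [exact: cvg_cst|exact: continuous_cos].
have cF : continuous F.
  by move=> x; apply/differentiable_continuous/derivable1_diffP; case: (DF x).
have -> : a - r = F (- (pi / 2)) by rewrite /F sinN sin_pihalf mulrN1.
have -> : a + r = F (pi / 2) by rewrite /F sin_pihalf mulr1.
rewrite /Rintegral integration_by_substitution_increasing; first last.
- apply: continuous_subspaceT => x; apply: cvgM; first exact: continuous_quadratic.
  by apply: cvgM; [exact: cvg_cst|exact: continuous_sqrt_disk].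
- split=> [x _||]; first by case: (DF x).
  + exact/cvg_at_right_filter/cF.
  + exact/cvg_at_left_filter/cF.
- by apply/cvg_ex; exists (r * cos (pi / 2)); rewrite dF; exact/cvg_at_left_filter/cdF.
- by apply/cvg_ex; exists (r * cos (- (pi / 2))); rewrite dF;
    exact/cvg_at_right_filter/cdF.
- by move=> x _; rewrite dF; exact: cdF.
- by move=> x y xI yI xy; rewrite /F ltrD2l ltr_pM2l // ltr_sin.
- by lra.
have E := Rintegral_trigonometric (2 * r ^+ 2 * A) (2 * r ^+ 3 * B) (2 * r ^+ 4 * C).
transitivity (2 * r ^+ 2 * A * pi / 2 + 2 * r ^+ 4 * C * pi / 8); last by field.
rewrite -E; apply: eq_Rintegral => x; rewrite inE /= in_itv /= => xI.
rewrite mulrfctE dF /= /F.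
have -> : a + r * sin x - a = r * sin x by ring.
have -> : r ^+ 2 - (r * sin x) ^+ 2 = (r * cos x) ^+ 2.
  by rewrite !exprMn cos2sin2; ring.
rewrite sqrtr_sqr ger0_norm; last by rewrite mulr_ge0 ?cos_ge0_pihalf // ltW.
by ring.
Qed.

Lemma measurable_indic_le d (T : measurableType d) (D : set T) (f g : T -> R) :
  measurable_fun D f -> measurable_fun D g ->
  measurable_fun D (fun x => (f x <= g x)%R%:R : R).
Proof.
move=> mf mg.
have mb : measurable_fun [set: bool] (fun b : bool => b%:R : mR).
  have -> : (fun b : bool => b%:R : mR) = (fun b => if b then 1 else 0).
    by apply/funext => -[].
  by apply: measurable_fun_ifT; [exact: measurable_id|exact: measurable_cst|exact:
    measurable_cst].
exact: (measurableT_comp mb (measurable_fun_ler mf mg)).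
Qed.

Section DiskIntegral.
Variables (a b r A B C D E F : R).
Hypothesis r_gt0 : 0 < r.

Let disk (z : R * R) : R := ((z.1 - a) ^+ 2 + (z.2 - b) ^+ 2 <= r ^+ 2)%R%:R.

Let quad (z : R * R) : R := A + B * (z.1 - a) + C * (z.2 - b) + D * (z.1 - a) ^+ 2
  + E * ((z.1 - a) * (z.2 - b)) + F * (z.2 - b) ^+ 2.

Let disk_le z : disk z != 0 -> `|z.1 - a| <= r /\ `|z.2 - b| <= r.
Proof.
rewrite /disk; case: leP => [h _|_]; last by rewrite eqxx.
by split; rewrite -(@ler_pXn2r _ 2) ?nnegrE ?normr_ge0 ?(ltW r_gt0) // real_normK
  ?num_real //;
  have := sqr_ge0 (z.1 - a); have := sqr_ge0 (z.2 - b); lra.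
Qed.

Let M : R := `|A| + `|B| * r + `|C| * r + `|D| * r ^+ 2 + `|E| * (r * r) + `|F| * r ^+
  2.

Let bounded z : `|disk z * quad z| <= M.
Proof.
have [d0|d0] := eqVneq (disk z) 0.
  by rewrite d0 mul0r normr0 /M !addr_ge0 // !mulr_ge0 // ?exprn_ge0 // ltW.
have [z1 z2] := disk_le d0.
have -> : disk z = 1 by move: d0; rewrite /disk; case: leP => // _; rewrite eqxx.
rewrite mul1r /quad /M.
have sq (x : R) : `|x| <= r -> `|x ^+ 2| <= r ^+ 2.
  by move=> xr; rewrite normrX ler_pXn2r // ?nnegrE // ltW.
have h1 : `|B * (z.1 - a)| <= `|B| * r by rewrite normrM ler_wpM2l.
have h2 : `|C * (z.2 - b)| <= `|C| * r by rewrite normrM ler_wpM2l.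
have h3 : `|D * (z.1 - a) ^+ 2| <= `|D| * r ^+ 2 by rewrite normrM ler_wpM2l // sq.
have h4 : `|E * ((z.1 - a) * (z.2 - b))| <= `|E| * (r * r).
  by rewrite normrM ler_wpM2l // normrM ler_pM.
have h5 : `|F * (z.2 - b) ^+ 2| <= `|F| * r ^+ 2 by rewrite normrM ler_wpM2l // sq.
by do 5 rewrite (le_trans (ler_normD _ _)) // lerD //.
Qed.

Let cD (f g : R * R -> R) : continuous f -> continuous g ->
  continuous (fun z => f z + g z).
Proof. by move=> cf cg z; apply: cvgD; [exact: cf|exact: cg]. Qed.

Let cM (f g : R * R -> R) : continuous f -> continuous g ->
  continuous (fun z => f z * g z).
Proof. by move=> cf cg z; apply: cvgM; [exact: cf|exact: cg]. Qed.

Let c1 : continuous (fun z : R * R => z.1 - a).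
Proof. by move=> z; apply: cvgB; [exact: cvg_fst|exact: cvg_cst]. Qed.

Let c2 : continuous (fun z : R * R => z.2 - b).
Proof. by move=> z; apply: cvgB; [exact: cvg_snd|exact: cvg_cst]. Qed.

Let cquad : continuous quad.
Proof.
have cZ (k : R) (f : R * R -> R) : continuous f -> continuous (fun z => k * f z).
  by move=> cf; apply: cM => // z; exact: cvg_cst.
apply: cD; last by apply/cZ/cM.
apply: cD; last by apply/cZ/cM.
apply: cD; last by apply/cZ/cM.
apply: cD; last exact: cZ.
apply: cD; last exact: cZ.
by move=> z; exact: cvg_cst.
Qed.

Let mf : measurable_fun [set: measurableTypeR R * measurableTypeR R] (fun z =>
  disk z * quad z).
Proof.
apply: measurable_funM.
  apply: measurable_indic_le; last exact: measurable_cst.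
  apply: continuous_measurable2; first exact: openT.
  move=> z _; apply: (@cD (fun z => (z.1 - a) ^+ 2) (fun z => (z.2 - b) ^+ 2));
    exact: cM.
by apply: continuous_measurable2; [exact: openT|move=> z _; exact: cquad].
Qed.

Let s x := Num.sqrt (r ^+ 2 - (x - a) ^+ 2).

(** [s x] is the half-chord at abscissa x, and the quadratic is regrouped by powers of y - b. Since
    [Num.sqrt] is 0 on negative numbers, off the shadow of the disk the chord formula would leave
    the point b; hence the explicit empty set. *)
Let slice x :
  (fun y => disk (x, y) * quad (x, y)) =
  (fun y => (A + B * (x - a) + D * (x - a) ^+ 2 + (C + E * (x - a)) * (y - b) + F * (y
    - b) ^+ 2)) \_
    (if `|x - a| <= r then `[b - s x, b + s x]%classic else set0).
Proof.
apply/funext => y; rewrite patchE.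
have [xr|xr] := leP `|x - a| r; last first.
  rewrite memNset //.
  have [->|/disk_le[/=]] := eqVneq (disk (x, y)) 0; first by rewrite mul0r.
  by rewrite leNgt xr.
have -> : (y \in `[b - s x, b + s x]%classic) = ((x - a) ^+ 2 + (y - b) ^+ 2 <= r ^+ 2).
  have h : 0 <= r ^+ 2 - (x - a) ^+ 2.
    rewrite subr_ge0 -(@real_normK _ (x - a)) ?num_real //.
    by rewrite ler_pXn2r ?nnegrE // ltW.
  rewrite mem_setE in_itv /= -ler_distl -lerBrDl.
  rewrite -[RHS](@ler_sqrt) // -/(s x).
  by rewrite sqrtr_sqr.
rewrite /disk /quad /=; case: leP => _; last by rewrite mul0r.
by rewrite mul1r; ring.
Qed.

Lemma disk_integral :
  \int[leb2 R]_z (((z.1 - a) ^+ 2 + (z.2 - b) ^+ 2 <= r ^+ 2)%R%:R *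
    (A + B * (z.1 - a) + C * (z.2 - b) + D * (z.1 - a) ^+ 2
     + E * ((z.1 - a) * (z.2 - b)) + F * (z.2 - b) ^+ 2)) =
  pi * r ^+ 2 * A + pi * r ^+ 4 / 4 * (D + F).
Proof.
have i2 : (leb2 R).-integrable setT (EFin \o (fun z => disk z * quad z)).
  pose K := `[a - r, a + r]%classic `*` `[b - r, b + r]%classic.
  apply: (@bounded_support_integrable _ (mR * mR)%type R (leb2 R) K _ M) => //.
  - by apply: measurableX; exact: measurable_itv.
  - apply: sf_prod_lty; [exact: measurable_itv|exact: measurable_itv|..];
      by rewrite /= lebesgue_measure_itv /=; case: ifP => // _; rewrite ltry.
  - move=> z nKz; apply/eqP; rewrite mulf_eq0; apply/orP; left; apply: contra_notT nKz.
    by move=> /disk_le[]; rewrite !ler_distl => z1 z2; split; rewrite /= in_itv.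
have i1 x : leb1.-integrable setT (fun y => (disk (x, y) * quad (x, y))%:E).
  rewrite -[X in _.-integrable _ X]/(EFin \o (fun y =>
    disk (x, y) * quad (x, y))) slice.
  rewrite -restrict_EFin; set I := (if _ then _ else _).
  have mI : measurable (I : set mR) by rewrite /I; case: ifP => // _;
    exact: measurable_itv.
  apply: (proj1 (integrable_mkcond _ mI)).
  rewrite /I; case: ifP => _; last exact: integrable_set0.
  apply: continuous_compact_integrable; first exact: segment_compact.
  exact/continuous_subspaceT/continuous_quadratic.
rewrite (Rintegral_fubini1 i2 i1).
(* The term odd in y - b drops out, and (2/3) s^3 F = 2 s (F/3) (r^2 - (x - a)^2) changes the
   coefficients [A] and [D] by + (F/3) r^2 and - F/3. *)
transitivity (\int[leb1]_(x in `[a - r, a + r])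
    (((A + F / 3 * r ^+ 2) + B * (x - a) + (D - F / 3) * (x - a) ^+ 2) *
       (2 * Num.sqrt (r ^+ 2 - (x - a) ^+ 2)))); last first.
  by rewrite Rintegral_sqrt_quadratic //; field.
rewrite [RHS]Rintegral_mkcond; congr Rintegral; apply/funext => x.
rewrite slice patchE mem_setE in_itv /= -ler_distl -Rintegral_mkcond.
case: ifP => xr; last by rewrite Rintegral_set0.
rewrite Rintegral_quadratic; last exact: sqrtr_ge0.
have -> : s x ^+ 3 = s x * (r ^+ 2 - (x - a) ^+ 2).
  rewrite exprS sqr_sqrtr // subr_ge0 -(@real_normK _ (x - a)) ?num_real //.
  by rewrite ler_pXn2r ?nnegrE // ltW.
by rewrite /s; field.
Qed.

End DiskIntegral.

End DiskMoments.

(** * Continuity and integrability over the phase space *)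

Section ContinuousOn.
Variable R : realType.
Implicit Types (T U : topologicalType).

Definition cont_on T U (D : set T) (f : T -> U) :=
  forall x, D x -> {for x, continuous f}.

Lemma cont_on_cst T U (D : set T) (a : U) : cont_on D (fun=> a).
Proof. by move=> x _; exact: cvg_cst. Qed.

Lemma cont_onD T (D : set T) (f g : T -> R) :
  cont_on D f -> cont_on D g -> cont_on D (fun x => f x + g x).
Proof. by move=> cf cg x Dx; apply: cvgD; [exact: cf|exact: cg]. Qed.

Lemma cont_onB T (D : set T) (f g : T -> R) :
  cont_on D f -> cont_on D g -> cont_on D (fun x => f x - g x).
Proof. by move=> cf cg x Dx; apply: cvgB; [exact: cf|exact: cg]. Qed.

Lemma cont_onM T (D : set T) (f g : T -> R) :
  cont_on D f -> cont_on D g -> cont_on D (fun x => f x * g x).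
Proof. by move=> cf cg x Dx; apply: cvgM; [exact: cf|exact: cg]. Qed.

Lemma cont_onV T (D : set T) (f : T -> R) : (forall x, D x -> f x != 0) ->
  cont_on D f -> cont_on D (fun x => (f x)^-1).
Proof. by move=> f0 cf x Dx; apply: cvgV; [exact: f0|exact: cf]. Qed.

Lemma cont_on_comp T U (W : topologicalType) (D : set T) (E : set U) (A : T -> U) (f :
  U -> W) :
  (forall x, D x -> E (A x)) -> cont_on D A -> cont_on E f ->
    cont_on D (fun x => f (A x)).
Proof. by move=> DE cA cf x Dx; apply: continuous_comp; [exact: cA|exact/cf/DE]. Qed.

Lemma continuous_cont_on T U (D : set T) (f : T -> U) : continuous f -> cont_on D f.
Proof. by move=> cf x _; exact: cf. Qed.

Lemma cont_on_fst T (V W : topologicalType) (D : set T) (f : T -> (V * W)%type) :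
  cont_on D f -> cont_on D (fun x => (f x).1).
Proof.
move=> cf; apply: (@cont_on_comp _ _ _ D setT) cf _ => //.
exact/continuous_cont_on/fst_continuous.
Qed.

Lemma cont_on_snd T (V W : topologicalType) (D : set T) (f : T -> (V * W)%type) :
  cont_on D f -> cont_on D (fun x => (f x).2).
Proof.
move=> cf; apply: (@cont_on_comp _ _ _ D setT) cf _ => //.
exact/continuous_cont_on/snd_continuous.
Qed.

End ContinuousOn.

Lemma prod_norm_le (R : realType) (V W : normedModType R) (x : (V * W)%type) r :
  (`|x| <= r) = (`|x.1| <= r) && (`|x.2| <= r).
Proof. by rewrite prod_normE ge_max. Qed.

Section PhaseSpace.
Variable R : realType.
Local Notation mR := (measurableTypeR R).
Variable Omega : set (spacetime R).
Hypothesis Omega_open : open Omega.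

Local Notation D := (phase_domain Omega).

Lemma phase_domain_open : open D.
Proof.
have -> : D = setT `&` (@fst (spacetime R) (velocity R)) @^-1` Omega.
  by rewrite setTI; apply/seteqP; split=> [q []|q].
exact: (preimage_open (@openT _) (fun x _ => @fst_continuous _ _ x) Omega_open).
Qed.

Lemma cont_on_phase1 (U : topologicalType) (f : spacetime R -> U) :
  cont_on Omega f -> cont_on D (fun q => f q.1).
Proof.
move=> cf; apply: (@cont_on_comp _ _ _ D Omega) cf; first by move=> q [].
exact/continuous_cont_on/fst_continuous.
Qed.

Lemma cont_on_phase2 (U : topologicalType) (f : velocity R -> U) :
  continuous f -> cont_on D (fun q => f q.2).
Proof.
move=> cf.
exact: (@cont_on_comp _ _ _ D setT snd f (fun _ _ =>
  I) (continuous_cont_on (@snd_continuous _ _))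
  (continuous_cont_on cf)).
Qed.

(** A class that contains the discontinuous equilibria, is stable under sums and products with
    continuous coefficients, and whose members become integrable once multiplied by a test
    function. *)
Definition locally_bounded_on (F : phase R -> R) :=
  measurable_fun (D : set ((mR * (mR * mR)) * (mR * mR))) (F : _ -> mR) /\
  forall K : set (phase R), compact K -> K `<=` D ->
    exists M, forall q, K q -> `|F q| <= M.

Lemma cont_on_locally_bounded F : cont_on D F -> locally_bounded_on F.
Proof.
move=> cF; split; first exact: (continuous_measurable5 phase_domain_open).
by move=> K cK KD; apply: bounded_on_compact => // x /KD; exact: cF.
Qed.

Lemma locally_boundedM F G : locally_bounded_on F -> locally_bounded_on G ->
  locally_bounded_on (fun q => F q * G q).
Proof.
move=> [mF bF] [mG bG]; split; first exact: measurable_funM.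
move=> K cK KD; have [M HM] := bF K cK KD; have [M' HM'] := bG K cK KD.
exists (`|M| * `|M'|) => q Kq; rewrite normrM ler_pM //.
  by rewrite (le_trans (HM q Kq)) // ler_norm.
by rewrite (le_trans (HM' q Kq)) // ler_norm.
Qed.

Lemma locally_boundedD F G : locally_bounded_on F -> locally_bounded_on G ->
  locally_bounded_on (fun q => F q + G q).
Proof.
move=> [mF bF] [mG bG]; split; first exact: measurable_funD.
move=> K cK KD; have [M HM] := bF K cK KD; have [M' HM'] := bG K cK KD.
by exists (M + M') => q Kq; rewrite (le_trans (ler_normD _ _)) // lerD ?HM ?HM'.
Qed.

Lemma compact_in_boxes (K : set (phase R)) : compact K ->
  exists r, K `<=` box3 r `*` box2 r.
Proof.
move=> /compact_bounded [M [_ HM]]; exists (`|M| + 1) => q Kq.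
have : `|q| <= `|M| + 1 by apply: HM Kq; rewrite (le_lt_trans (ler_norm M)) // ltrDl.
by rewrite prod_norm_le => /andP[q1 q2]; split; [exact/box3P|exact/box2P].
Qed.

Section LocallyBoundedTest.
Variables (F Phi : phase R -> R).
Hypothesis LF : locally_bounded_on F.
Hypothesis cPhi : continuous Phi.
Hypothesis KPhi : compact (supp Phi).
Hypothesis DPhi : supp Phi `<=` D.

Lemma locally_bounded_measurable :
  measurable_fun [set: ((mR * (mR * mR)) * (mR * mR))] (fun q => F q * Phi q : mR).
Proof.
have -> : (fun q => F q * Phi q) = (fun q => F q * Phi q) \_ D.
  apply/funext => q; rewrite patchE; case: ifPn => //; rewrite notin_setE => nDq.
  by rewrite (@notin_supp _ _ Phi) ?mulr0 // => /DPhi.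
apply/(measurable_restrictT _ (open_measurable5 phase_domain_open)).
apply: measurable_funM; first by case: LF.
by apply: (continuous_measurable5 phase_domain_open) => x _; exact: cPhi.
Qed.

Lemma locally_bounded_bound : exists r M, (forall q, `|F q * Phi q| <= M) /\
  (forall q, ~ (box3 r `*` box2 r) q -> F q * Phi q = 0).
Proof.
have [r Kr] := compact_in_boxes KPhi; exists r.
have [M HM] := LF.2 _ KPhi DPhi.
have [M' HM'] := bounded_on_compact KPhi (fun x _ => @cPhi x).
exists (`|M| * `|M'|); split=> q; last first.
  by move=> nq; rewrite (@notin_supp _ _ Phi) ?mulr0 // => /Kr.
have [sq|nsq] := pselect (supp Phi q); last by rewrite (notin_supp nsq) mulr0 normr0
  mulr_ge0.
rewrite normrM ler_pM //.
  by rewrite (le_trans (HM q sq)) // ler_norm.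
by rewrite (le_trans (HM' q sq)) // ler_norm.
Qed.

Lemma locally_bounded_integrable :
  (leb5 R).-integrable setT (EFin \o (fun q => F q * Phi q)).
Proof.
have [r [M [bM b0]]] := locally_bounded_bound.
apply: (@bounded_support_integrable _ ((mR * (mR * mR)) * (mR * mR))%type R (leb5 R)
  (box3 r `*` box2 r) _ M) => //.
- by apply: measurableX; [exact: measurable_box3|exact: measurable_box2].
- exact: box5_fin.
- exact: locally_bounded_measurable.
Qed.

Lemma locally_bounded_slice p :
  (leb2 R).-integrable setT (EFin \o (fun z => F (p, z) * Phi (p, z))).
Proof.
have [r [M [bM b0]]] := locally_bounded_bound.
apply: (@bounded_support_integrable _ (mR * mR)%type R (leb2 R) (box2 r) _ M) => //.
- exact: measurable_box2.
- exact: box2_fin.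
- exact: (measurableT_comp locally_bounded_measurable (pair1_measurable p)).
- by move=> z nz; apply: b0 => -[].
Qed.

Lemma distr_ofE : distr_of Omega F Phi = \int[leb5 R]_q (F q * Phi q).
Proof.
rewrite /distr_of Rintegral_supp // => q nDq.
by rewrite (@notin_supp _ _ Phi) ?mulr0 // => /DPhi.
Qed.

Lemma distr_of_fubini :
  distr_of Omega F Phi = \int[leb3 R]_p \int[leb2 R]_z (F (p, z) * Phi (p, z)).
Proof.
rewrite distr_ofE.
exact: (Rintegral_fubini1 locally_bounded_integrable locally_bounded_slice).
Qed.

End LocallyBoundedTest.

End PhaseSpace.

(** * Moments of the equilibria *)

Section EquilibriumMoments.
Variable R : realType.
Variable Omega : set (spacetime R).
Hypothesis Omega_open : open Omega.
Variables (g : R) (h : spacetime R -> R).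
Hypothesis g_gt0 : 0 < g.
Hypothesis h_cont : cont_on Omega h.
Hypothesis h_gt0 : forall p, Omega p -> 0 < h p.

Local Notation D := (phase_domain Omega).
Local Notation c := (celerity g h).

Lemma celerity_gt0 p : Omega p -> 0 < c p.
Proof. by move=> Op; rewrite sqrtr_gt0 divr_gt0 // mulr_gt0 // h_gt0. Qed.

Lemma celerity_sqr p : Omega p -> c p ^+ 2 = g * h p / 2.
Proof. by move=> Op; rewrite sqr_sqrtr // divr_ge0 // mulr_ge0 // ltW // h_gt0. Qed.

Lemma celerity_cont : cont_on Omega c.
Proof.
apply: (@cont_on_comp _ _ _ Omega setT (fun p => g * h p / 2) Num.sqrt) => //.
  apply: cont_onM; last exact: cont_on_cst.
  by apply: cont_onM => //; exact: cont_on_cst.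
exact/continuous_cont_on/sqrt_continuous.
Qed.

Section PointwiseEquilibrium.
Variables (m : spacetime R -> R) (w : spacetime R -> velocity R).
Local Notation eqm := (equilibrium g h m w).

(** Clearing the celerity from the arguments of [chi0] displays a constant on the disk of radius 2c,
    that is, of squared radius 2 g h. *)
Lemma equilibriumE p z : Omega p ->
  eqm (p, z) = m p / (4 * pi * c p ^+ 2) *
    ((z.1 - (w p).1) ^+ 2 + (z.2 - (w p).2) ^+ 2 <= (2 * c p) ^+ 2)%R%:R.
Proof.
move=> /celerity_gt0 c0; have c20 : 0 < c p ^+ 2 by rewrite exprn_gt0.
rewrite /equilibrium /chi0 /= !expr_div_n -mulrDl ler_pdivrMr //.
have -> : 4 * c p ^+ 2 = (2 * c p) ^+ 2 by ring.
by rewrite mulrA; congr (_ * _); rewrite [in RHS]invfM; ring.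
Qed.

Variables (k0 k1 k2 k11 k12 k22 : R).
Let k (z : velocity R) : R := k0 + k1 * z.1 + k2 * z.2 + k11 * z.1 ^+ 2
  + k12 * (z.1 * z.2) + k22 * z.2 ^+ 2.

(** With r = 2c and height m / (4 pi c^2), the mass pi r^2 becomes m and the second moment pi r^4 /
    4 becomes m c^2, which is m g h / 2 in each direction. Mixed and odd centred moments vanish. *)
Lemma equilibrium_integral p : Omega p ->
  \int[leb2 R]_z (eqm (p, z) * k z) = m p * (k (w p) + (k11 + k22) * (g * h p / 2)).
Proof.
move=> Op; have c0 := celerity_gt0 Op; have c20 : 0 < 2 * c p by rewrite mulr_gt0.
set a := (w p).1; set b := (w p).2.
(* The coefficients are those of the Taylor expansion of [k] at the centre [w p], multiplied by the
   height of the equilibrium. *)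
have := @disk_integral R a b (2 * c p)
  (m p / (4 * pi * c p ^+ 2) * k (w p))
  (m p / (4 * pi * c p ^+ 2) * (k1 + 2 * k11 * a + k12 * b))
  (m p / (4 * pi * c p ^+ 2) * (k2 + 2 * k22 * b + k12 * a))
  (m p / (4 * pi * c p ^+ 2) * k11) (m p / (4 * pi * c p ^+ 2) * k12)
  (m p / (4 * pi * c p ^+ 2) * k22) c20.
set I := (X in X = _ -> _) => HI.
transitivity I.
  apply: eq_Rintegral => z _; rewrite equilibriumE // -/a -/b /k.
  ring.
rewrite HI -celerity_sqr //; move: (@pi R) (pi_gt0 R) => P P0; field.
by rewrite (gt_eqF c0) (gt_eqF P0).
Qed.

End PointwiseEquilibrium.

Section OneEquilibrium.
Variables (m : spacetime R -> R) (w : spacetime R -> velocity R).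
Hypothesis m_cont : cont_on Omega m.
Hypothesis w_cont : cont_on Omega w.

Local Notation eqm := (equilibrium g h m w).

Lemma equilibrium_locally_bounded : locally_bounded_on Omega eqm.
Proof.
have cc : cont_on D (fun q => (c q.1)^-1).
  apply: cont_onV; last exact: cont_on_phase1 celerity_cont.
  by move=> q [/celerity_gt0 c0 _]; rewrite gt_eqF.
apply: locally_boundedM.
  apply: cont_on_locally_bounded => //; apply: (cont_on_phase1 (f :=
    fun p => m p / c p ^+ 2)).
  apply: cont_onM => //; apply: cont_onV; last by apply: cont_onM; exact: celerity_cont.
  by move=> p /celerity_gt0 c0; rewrite gt_eqF // exprn_gt0.
split; last first.
  move=> K _ _; exists `|(4 * pi)^-1| => q _; rewrite /chi0 normrM ler_piMr //.
  by rewrite normr_nat lern1 leq_b1.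
apply: measurable_funM; first exact: measurable_cst.
apply: measurable_indic_le; last exact: measurable_cst.
apply: (continuous_measurable5 (phase_domain_open Omega_open)).
have c1 : cont_on D (fun q => (q.2.1 - (w q.1).1) / c q.1).
  apply: cont_onM => //; apply: cont_onB.
    exact: (cont_on_phase2 (@fst_continuous _ _)).
  exact: (cont_on_phase1 (cont_on_fst w_cont)).
have c2 : cont_on D (fun q => (q.2.2 - (w q.1).2) / c q.1).
  apply: cont_onM => //; apply: cont_onB.
    exact: (cont_on_phase2 (@snd_continuous _ _)).
  exact: (cont_on_phase1 (cont_on_snd w_cont)).
by apply: cont_onD; apply: cont_onM.
Qed.

(** The source of all cutoff radii: on [K] the centre and the celerity are bounded, and a point of
    the disk is within 2c of the centre in each coordinate. The final + 1 makes the bound strict, so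
    a cutoff equal to 1 on the ball also has zero derivative at such [z]. *)
Lemma equilibrium_radius (K : set (spacetime R)) : compact K -> K `<=` Omega ->
  exists r, forall p z, K p -> eqm (p, z) != 0 -> `|z| < r.
Proof.
move=> cK KO.
have [M1 H1] := bounded_on_compact cK (fun p Kp => cont_on_fst w_cont (KO p Kp)).
have [M2 H2] := bounded_on_compact cK (fun p Kp => cont_on_snd w_cont (KO p Kp)).
have [M3 H3] := bounded_on_compact cK (fun p Kp => celerity_cont (KO p Kp)).
exists (`|M1| + `|M2| + 2 * `|M3| + 1) => p z Kp; rewrite equilibriumE; last exact: KO.
have [zd _|_] := leP ((z.1 - (w p).1) ^+ 2 + (z.2 - (w p).2) ^+ 2) ((2 * c p) ^+ 2);
  last by rewrite mulr0 eqxx.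
have c0 := celerity_gt0 (KO p Kp).
have aux (x y : R) : x ^+ 2 + y ^+ 2 <= (2 * c p) ^+ 2 -> `|x| <= 2 * c p.
  move=> xy; rewrite -(@ler_pXn2r _ 2) ?nnegrE ?mulr_ge0 ?(ltW c0) // real_normK
    ?num_real //.
  by apply: le_trans xy; rewrite lerDl sqr_ge0.
have z1 := aux _ _ zd; rewrite addrC in zd; have z2 := aux _ _ zd.
have c3 : c p <= `|M3| by rewrite (le_trans _ (ler_norm _)) // (le_trans _ (H3 p Kp))
  // ler_norm.
have w1 : `|(w p).1| <= `|M1| by rewrite (le_trans (H1 p Kp)) // ler_norm.
have w2 : `|(w p).2| <= `|M2| by rewrite (le_trans (H2 p Kp)) // ler_norm.
have n1 := ler_normD (z.1 - (w p).1) (w p).1; rewrite subrK in n1.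
have n2 := ler_normD (z.2 - (w p).2) (w p).2; rewrite subrK in n2.
have := normr_ge0 M1; have := normr_ge0 M2 => M20 M10.
apply: (@le_lt_trans _ _ (`|M1| + `|M2| + 2 * `|M3|)); last by rewrite ltrDl.
by rewrite prod_norm_le; apply/andP; split; lra.
Qed.

Variables (k0 k1 k2 k11 k12 k22 : R).
Let k (z : velocity R) : R := k0 + k1 * z.1 + k2 * z.2 + k11 * z.1 ^+ 2
  + k12 * (z.1 * z.2) + k22 * z.2 ^+ 2.

(** [kp] is the velocity factor contributed by the kinetic operator and [kappa] the one of the test
    function; only their product matters, and only on the velocity support of the equilibrium, where
    it is the quadratic [k]. *)
Lemma equilibrium_moment (C psi : spacetime R -> R) (kp kappa : velocity R -> R) :
  cont_on Omega C -> continuous kp ->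
  test_function Omega psi -> smooth kappa -> compact (supp kappa) ->
  (forall p z, supp psi p -> eqm (p, z) != 0 -> kp z * kappa z = k z) ->
  distr_of Omega (fun q => C q.1 * kp q.2 * eqm q) (fun q => psi q.1 * kappa q.2) =
  \int[leb3 R]_(p in Omega)
     (C p * (m p * (k (w p) + (k11 + k22) * (g * h p / 2))) * psi p).
Proof.
move=> cC ckp tpsi skappa ckappa Hk.
have [sPhi cPhi DPhi] := test_function_tensor tpsi (And3 skappa ckappa (@subsetT _ _)).
have LF : locally_bounded_on Omega (fun q => C q.1 * kp q.2 * eqm q).
  apply: locally_boundedM equilibrium_locally_bounded.
  apply: cont_on_locally_bounded => //.
  by apply: cont_onM; [exact: cont_on_phase1|exact: cont_on_phase2].
rewrite (distr_of_fubini Omega_open LF (smooth_continuous sPhi) cPhi DPhi).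
rewrite [RHS]Rintegral_supp; last first.
  by move=> p /(test_function_out tpsi) ->; rewrite mulr0.
congr Rintegral; apply/funext => p /=.
have [sp|nsp] := pselect (supp psi p); last first.
  rewrite (notin_supp nsp) mulr0; apply: Rintegral_eq0 => z _.
  by rewrite mul0r mulr0.
have Op : Omega p by case: tpsi => _ _; exact.
(* An equilibrium is linear in its mass, so [C] and [psi], constant in velocity, are absorbed into
   it. *)
have := @equilibrium_integral (fun p => C p * m p * psi p) w k0 k1 k2 k11 k12 k22 p Op.
rewrite -/(k (w p)) => E; transitivity (C p * m p * psi p *
    (k (w p) + (k11 + k22) * (g * h p / 2))); last by ring.
rewrite -E; apply: eq_Rintegral => z _; rewrite -/(k z).
have -> : equilibrium g h (fun p => C p * m p * psi p) w (p, z) = C p * psi p * eqm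
  (p, z).
  by rewrite /equilibrium /=; ring.
have [->|e0] := eqVneq (eqm (p, z)) 0; first by rewrite !(mul0r, mulr0).
rewrite -(Hk p z sp e0); ring.
Qed.

End OneEquilibrium.
End EquilibriumMoments.

(** * Derivatives of tensor products and of vector fields; linearity of tested integrals *)

Section TensorDerivatives.
Variable R : realType.
Implicit Types V W : normedModType R.

(** Along [(v, 0)] the second factor is frozen, so the difference quotient is that of [f] times the
    constant [k y]. *)
Lemma derive_tensor1 V W (f : V -> R) (k : W -> R) (v : V) : smooth f ->
  'D_((v, 0) : (V * W)%type) (fun q => f q.1 * k q.2) = fun q => 'D_v f q.1 * k q.2.
Proof.
move=> sf; apply/funext => -[x y] /=.
have Df := smooth_is_derive v x sf.
have H : is_derive ((x, y) : (V * W)%type) (v, 0) (fun q =>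
  k y * f q.1) (k y * 'D_v f x).
  apply: (@is_derive_affine _ _ _ _ fst fst (fun x => k y * f x)) => //.
have -> : 'D_((v, 0) : (V * W)%type) (fun q => f q.1 * k q.2) (x, y) =
    'D_((v, 0) : (V * W)%type) (fun q => k y * f q.1) (x, y).
  rewrite /derive; set F := fun h => _; set G := fun h => _.
  suff -> : F = G by [].
  by apply/funext => t; rewrite /F /G /= scaler0 add0r !(mulrC (k y)).
by case: H => _ ->; rewrite mulrC.
Qed.

Lemma derive_tensor2 V W (f : V -> R) (k : W -> R) (v : W) : smooth k ->
  'D_((0, v) : (V * W)%type) (fun q => f q.1 * k q.2) = fun q => f q.1 * 'D_v k q.2.
Proof.
move=> sf; apply/funext => -[x y] /=.
have Df := smooth_is_derive v y sf.
have H : is_derive ((x, y) : (V * W)%type) (0, v) (fun q =>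
  f x * k q.2) (f x * 'D_v k y).
  apply: (@is_derive_affine _ _ _ _ snd snd (fun y => f x * k y)) => //.
have -> : 'D_((0, v) : (V * W)%type) (fun q => f q.1 * k q.2) (x, y) =
    'D_((0, v) : (V * W)%type) (fun q => f x * k q.2) (x, y).
  rewrite /derive; set F := fun h => _; set G := fun h => _.
  suff -> : F = G by [].
  by apply/funext => t; rewrite /F /G /= scaler0 add0r.
by case: H => _ ->.
Qed.

Lemma derive_fst V W W' (D : set V) (f : V -> (W * W')%type) v x :
  Ck 1 D f -> D x -> ('D_v f x).1 = 'D_v (fun y => (f y).1) x.
Proof.
move=> Cf Dx; apply/esym.
have := @is_derive_linear R V _ W fst f v x _ _ (@fst_continuous _ _) (Ck_is_derive v
  Cf Dx).
by move=> /(_ (fun _ _ _ => erefl)) [].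
Qed.

Lemma derive_snd V W W' (D : set V) (f : V -> (W * W')%type) v x :
  Ck 1 D f -> D x -> ('D_v f x).2 = 'D_v (fun y => (f y).2) x.
Proof.
move=> Cf Dx; apply/esym.
have := @is_derive_linear R V _ W' snd f v x _ _ (@snd_continuous _ _) (Ck_is_derive v
  Cf Dx).
by move=> /(_ (fun _ _ _ => erefl)) [].
Qed.

Lemma is_derive_pair V W W' (f : V -> W) (f' : V -> W') v x df df' :
  is_derive x v f df -> is_derive x v f' df' ->
  is_derive x v (fun x => (f x, f' x)) (df, df').
Proof.
move=> [d <-] [d' <-].
have cv : (fun h => h^-1 *: (((fun x => (f x, f' x)) \o shift x) (h *:
  v) - (f x, f' x)))
    @ 0^' --> ('D_v f x, 'D_v f' x).
  by apply: cvg_pair; [exact: d|exact: d'].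
by split; [apply/cvg_ex; eexists; exact: cv|exact/cvg_lim].
Qed.

Lemma Ck_pair V W W' k (D : set V) (f : V -> W) (f' : V -> W') : open D ->
  Ck k D f -> Ck k D f' -> Ck k D (fun x => (f x, f' x)).
Proof.
move=> oD; elim: k f f' => [f f' [cf _] [cf' _]|k IH f f' Cf Cf'].
  by split=> // x Dx; apply: cvg_pair; [exact: cf|exact: cf'].
apply: (@Ck_S _ _ _ _ _ _ (fun v x => ('D_v f x, 'D_v f' x))) => //.
- by move=> x Dx; apply: cvg_pair; [exact: (Ck_continuous Cf)|exact:
    (Ck_continuous Cf')].
- by move=> v x Dx; apply: is_derive_pair; [exact: (Ck_is_derive _ Cf)|exact:
    (Ck_is_derive _ Cf')].
- by move=> v; apply: IH; exact: Ck_derive.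
Qed.

Lemma Ck_scale_pair V k (D : set V) (c : V -> R) (f : V -> velocity R) : open D ->
  Ck k D c -> Ck k D f -> Ck k D (fun x => c x *: f x).
Proof.
move=> oD Cc Cf; apply: (@Ck_pair _ _ _ _ _ (fun x => c x * (f x).1) (fun x =>
  c x * (f x).2)) => //.
  by apply: CkM => //; exact: Ck_fst.
by apply: CkM => //; exact: Ck_snd.
Qed.

Lemma is_derive_lin3 V (D : set V) (a0 a1 a2 : R) (f0 f1 f2 : V -> R) v x :
  Ck 1 D f0 -> Ck 1 D f1 -> Ck 1 D f2 -> D x ->
  'D_v (fun x => a0 * f0 x + a1 * f1 x + a2 * f2 x) x =
  a0 * 'D_v f0 x + a1 * 'D_v f1 x + a2 * 'D_v f2 x.
Proof.
move=> C0 C1 C2 Dx.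
have H0 := Ck_is_derive v C0 Dx; have H1 := Ck_is_derive v C1 Dx.
have H2 := Ck_is_derive v C2 Dx.
by have [] := is_deriveD (is_deriveD (is_deriveZ a0 H0) (is_deriveZ a1 H1))
  (is_deriveZ a2 H2).
Qed.

Lemma Rintegral_test_lin (D : set (spacetime R)) (a : R) (F G phi : spacetime R -> R) :
  open D -> cont_on D F -> cont_on D G -> test_function D phi ->
  \int[leb3 R]_(p in D) (F p * phi p) + a * \int[leb3 R]_(p in D) (G p * phi p) =
  \int[leb3 R]_(p in D) ((F p + a * G p) * phi p).
Proof.
move=> oD cF cG tphi.
have out H x : ~ D x -> H x * phi x = 0.
  by move=> /(test_function_out tphi) ->; rewrite mulr0.
rewrite (Rintegral_supp (leb3 R) (out F)) (Rintegral_supp (leb3 R) (out G)).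
rewrite (Rintegral_supp (leb3 R) (out (fun p => F p + a * G p))).
have iF := Cc_integrable3 (test_function_Cc oD cF tphi).
have iG := Cc_integrable3 (test_function_Cc oD cG tphi).
rewrite -RintegralZl // -RintegralD //.
  by congr Rintegral; apply/funext => p; ring.
exact: (integrableZl measurableT a iG).
Qed.

Lemma Rintegral_testD (D : set (spacetime R)) (F G phi : spacetime R -> R) :
  open D -> cont_on D F -> cont_on D G -> test_function D phi ->
  \int[leb3 R]_(p in D) (F p * phi p) + \int[leb3 R]_(p in D) (G p * phi p) =
  \int[leb3 R]_(p in D) ((F p + G p) * phi p).
Proof.
move=> oD cF cG tphi; have := Rintegral_test_lin 1 oD cF cG tphi.
by rewrite mul1r => ->; apply: eq_Rintegral => p _; rewrite mul1r.
Qed.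

Lemma Rintegral_testB (D : set (spacetime R)) (F G phi : spacetime R -> R) :
  open D -> cont_on D F -> cont_on D G -> test_function D phi ->
  \int[leb3 R]_(p in D) (F p * phi p) - \int[leb3 R]_(p in D) (G p * phi p) =
  \int[leb3 R]_(p in D) ((F p - G p) * phi p).
Proof.
move=> oD cF cG tphi; have := Rintegral_test_lin (-1) oD cF cG tphi.
by rewrite mulN1r => ->; apply: eq_Rintegral => p _; rewrite mulN1r.
Qed.

End TensorDerivatives.

(** * The layer-averaged system *)

Section LayerFields.
Variables (R : realType) (g : R) (N : nat) (l : nat -> R).
Variables (zb : R * R -> R) (Omega : set (spacetime R)).
Variables (h : spacetime R -> R) (u : nat -> spacetime R -> velocity R).
Hypothesis l_sum : \sum_(1 <= a < N.+1) l a = 1.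
Hypothesis Omega_open : open Omega.
Hypothesis h_C1 : Ck 1 Omega h.
Hypothesis u_C1 : forall a, (1 <= a <= N)%N -> Ck 1 Omega (u a).

Local Notation H a := (layer_depth l h a).
Local Notation HU a := (discharge l h u a).
Local Notation G := (exchange N l h u).
Local Notation up := (upwind N l h u).

Lemma layer_depth_C1 a : Ck 1 Omega (H a).
Proof. exact: CkZ. Qed.

Lemma discharge_C1 a : (1 <= a <= N)%N -> Ck 1 Omega (HU a).
Proof. by move=> aN; exact: (Ck_scale_pair Omega_open (layer_depth_C1 a) (u_C1 aN)).
  Qed.

Lemma div_cont (F : spacetime R -> velocity R) : Ck 1 Omega F -> cont_on Omega (div F).
Proof.
move=> CF; apply: cont_onD; apply: (@Ck_continuous _ _ _ 0); apply: Ck_derive.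
  exact: Ck_fst.
exact: Ck_snd.
Qed.

(** At the bottom [upwind] selects the meaningless value [u 0]; the vanishing exchange removes it
    from every formula. *)
Lemma exchange0 p : G 0 p = 0.
Proof.
rewrite /exchange big_nat big1 ?oppr0 // => j /andP[j1 _].
by rewrite big_geq // leqNgt j1 subrr mul0r.
Qed.

Lemma exchangeN p : G N p = 0.
Proof.
rewrite /exchange big_nat big1 ?oppr0 // => j /andP[_ jN].
by rewrite l_sum -ltnS jN subrr mul0r.
Qed.

Lemma cont_on_sum (T : topologicalType) (D : set T) (s : seq nat) (P : pred nat)
    (F : nat -> T -> R) :
  (forall i, i \in s -> P i -> cont_on D (F i)) ->
  cont_on D (fun x => \sum_(i <- s | P i) F i x).
Proof.
elim: s => [|i s IH] cF.
  rewrite (_ : (fun x => _) = fun=> 0); first exact: cont_on_cst.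
  by apply/funext => x; rewrite big_nil.
have cs : cont_on D (fun x => \sum_(j <- s | P j) F j x).
  by apply: IH => j js; apply: cF; rewrite inE js orbT.
rewrite (_ : (fun x => _) = (fun x => if P i then F i x + \sum_(j <- s | P j) F j x
    else \sum_(j <- s | P j) F j x)); last by apply/funext => x; rewrite big_cons.
case Pi: (P i); last exact: cs.
by apply: (cont_onD _ cs) => //; apply: cF; rewrite ?mem_head.
Qed.

Lemma exchange_cont a : cont_on Omega (G a).
Proof.
have cS : cont_on Omega (fun p => \sum_(1 <= j < N.+1)
    (\sum_(1 <= i < a.+1) l i - (j <= a)%N%:R) * div (HU j) p).
  apply: cont_on_sum => j; rewrite mem_index_iota ltnS => jN _.
  by apply: cont_onM; [exact: cont_on_cst|exact/div_cont/discharge_C1].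
by move=> p Op; apply: cvgN; exact: cS.
Qed.

(** The coefficients of [div (HU j)] at two consecutive interfaces differ by [l a] minus the
    indicator of j = a. *)
Lemma exchange_diff a p : (1 <= a <= N)%N ->
  G a p - G a.-1 p = div (HU a) p - l a * \sum_(1 <= j < N.+1) div (HU j) p.
Proof.
case: a => // a /= aN.
have Sl : \sum_(1 <= i < a.+2) l i = \sum_(1 <= i < a.+1) l i + l a.+1.
  by rewrite big_nat_recr.
rewrite /exchange Sl opprK addrC -sumrB big_distrr /=.
transitivity (\sum_(1 <= j < N.+1)
    ((j == a.+1)%:R * div (HU j) p - l a.+1 * div (HU j) p)); last first.
  rewrite sumrB; congr (_ - _); rewrite (bigD1_seq a.+1) ?iota_uniq //=; last first.
    by rewrite mem_index_iota ltnS.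
  by rewrite eqxx mul1r big1 ?addr0 // => j /negPf ->; rewrite mul0r.
apply: eq_bigr => j _.
have -> : (j <= a.+1)%N%:R = (j <= a)%N%:R + (j == a.+1)%:R :> R.
  by rewrite -natrD leq_eqVlt ltnS; case: eqP => [->|_]; rewrite ?ltnn ?addn0.
ring.
Qed.

(* The positive and negative parts of the exchange term turn the discontinuous
   upwind equilibrium into a sum of two equilibria with continuous coefficients. *)
Lemma upwind_split a : (a <= N)%N ->
  exists m1 m2 : spacetime R -> R, exists w1 w2 : spacetime R -> velocity R,
  [/\ cont_on Omega m1, cont_on Omega m2, cont_on Omega w1 & cont_on Omega w2] /\
  [/\ forall q, Neq g N l h u a q = equilibrium g h m1 w1 q + equilibrium g h m2 w2 q,
      forall p, G a p = m1 p + m2 p &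
      forall p, G a p *: up a p = m1 p *: w1 p + m2 p *: w2 p].
Proof.
move=> aN.
(* At interior interfaces both neighbouring velocities are layers of class C^1. At the two
   boundaries one neighbour is out of range, but there the exchange vanishes and zero equilibria
   will do. *)
have [[a1 aN1]|G0] : (1 <= a /\ a.+1 <= N)%N \/ forall p, G a p = 0.
- have [->|a0] := posnP a; first by right; exact: exchange0.
  by move: aN; rewrite leq_eqVlt => /orP[/eqP->|aN]; [right; exact: exchangeN|left].
- have cG := @exchange_cont a.
  have cnG : cont_on Omega (fun p => `|G a p|).
    by move=> p Op; apply: (@continuous_comp _ _ _ (G a));
      [exact: cG|exact: norm_continuous].
  have uc b : (1 <= b <= N)%N -> cont_on Omega (u b).
    by move=> bN; exact: (Ck_continuous (u_C1 bN)).
  exists (fun p => (G a p - `|G a p|) * 2^-1), (fun p => (G a p + `|G a p|) * 2^-1).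
  exists (u a), (u a.+1); split.
    split; [|..|by apply: uc; rewrite a1|exact: uc].
      by apply: cont_onM; [exact: cont_onB|exact: cont_on_cst].
    by apply: cont_onM; [exact: cont_onD|exact: cont_on_cst].
  have key p : [/\ G a p <= 0, (G a p - `|G a p|) * 2^-1 = G a p & (G a p + `|G a p|)
    * 2^-1 = 0] \/
     [/\ (G a p <= 0) = false, (G a p - `|G a p|) * 2^-1 = 0 & (G a p + `|G a p|) *
       2^-1 = G a p].
    have [Gp|Gp] := leP (G a p) 0.
      by left; rewrite ler0_norm //; split=> //; [field|ring].
    by right; rewrite gtr0_norm //; split=> //; [ring|field].
  split=> [q|p|p].
  - rewrite /Neq /equilibrium /upwind.
    by have [[-> -> ->]|[-> -> ->]] := key q.1; ring.
  - by field.
  - by rewrite /upwind; have [[-> -> ->]|[-> -> ->]] := key p;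
      rewrite scale0r ?addr0 ?add0r.
- exists (fun=> 0), (fun=> 0), (fun=> 0), (fun=> 0); split; first by split;
    exact: cont_on_cst.
  split=> [q|p|p]; rewrite /Neq /equilibrium ?G0; [ring|by rewrite addr0|].
  by rewrite !scale0r addr0.
Qed.

Definition mass_residual a p : R := 'D_(e_t R) (H a) p + div (HU a) p - (G a p - G
  a.-1 p).

Definition momentum_residual a p : velocity R :=
  'D_(e_t R) (HU a) p + div_tensor (HU a) (u a) p
  + grad (fun q => g / 2 * (h q * H a q)) p
  + (g * H a p) *: grad (Defs.bottom zb) p
  - (G a p *: up a p - G a.-1 p *: up a.-1 p).

Lemma momentum_residualP a p :
  momentum_equation g N l zb h u a p <-> momentum_residual a p = 0.
Proof.
have zmodP (V : zmodType) (L x y z : V) : L = - x + y - z <-> L + x - (y - z) = 0.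
  rewrite -(addrA (- x)); split=> [->|/eqP]; first by rewrite [- x + _]addrC subrK
    subrr.
  by rewrite subr_eq0 -[X in _ + X == _]opprK subr_eq addrC => /eqP.
rewrite /momentum_equation scaleNr; exact: zmodP.
Qed.

End LayerFields.

(** * Moments of the kinetic operator *)

Section KineticMoments.
Variables (R : realType) (g : R) (N : nat) (l : nat -> R).
Variables (zb : R * R -> R) (Omega : set (spacetime R)).
Variables (h : spacetime R -> R) (u : nat -> spacetime R -> velocity R).
Hypothesis g_gt0 : 0 < g.
Hypothesis l_sum : \sum_(1 <= a < N.+1) l a = 1.
Hypothesis Omega_open : open Omega.
Hypothesis zb_C1 : Ck 1 Omega (fun p : spacetime R => zb p.2).
Hypothesis h_C1 : Ck 1 Omega h.
Hypothesis u_C1 : forall a, (1 <= a <= N)%N -> Ck 1 Omega (u a).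
Hypothesis h_gt0 : forall p, Omega p -> 0 < h p.

Local Notation H a := (layer_depth l h a).
Local Notation HU a := (discharge l h u a).
Local Notation G := (exchange N l h u).
Local Notation up := (upwind N l h u).
Local Notation leb3 := (leb3 R).

Let h_cont : cont_on Omega h := Ck_continuous h_C1.

Lemma distr_ofD (F F' Phi : phase R -> R) :
  locally_bounded_on Omega F -> locally_bounded_on Omega F' ->
  test_function (phase_domain Omega) Phi ->
  distr_of Omega (fun q => F q + F' q) Phi = distr_of Omega F Phi + distr_of Omega F'
    Phi.
Proof.
move=> LF LF' [sP cP DP]; have coP := smooth_continuous sP.
rewrite !(distr_ofE _ DP) -RintegralD //; [|exact:
  (locally_bounded_integrable Omega_open LF coP cP DP)
  |exact: (locally_bounded_integrable Omega_open LF' coP cP DP)].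
by congr Rintegral; apply/funext => q; rewrite mulrDl.
Qed.

Section OneMoment.
Variables (m : spacetime R -> R) (w : spacetime R -> velocity R).
Hypothesis m_cont : cont_on Omega m.
Hypothesis w_cont : cont_on Omega w.
Variables (phi : spacetime R -> R) (chi : velocity R -> R) (r a0 a1 a2 : R).
Hypothesis tphi : test_function Omega phi.
Hypothesis tchi : test_function setT chi.
Hypothesis chi1 : forall z, `|z| <= r -> chi z = 1.
Hypothesis wr : forall p z, supp phi p -> equilibrium g h m w (p, z) != 0 -> `|z| < r.

Let kappa (z : velocity R) : R := (a0 + a1 * z.1 + a2 * z.2) * chi z.

Lemma cutoff_smooth : smooth kappa.
Proof.
have [sc _ _] := tchi; move=> k; apply: CkM => //; first exact: openT.
have oT := @openT (velocity R).
have C1 : Ck k setT (fun z : velocity R => z.1) :=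
  @smooth_comp_fst R R R _ (@smooth_id R) k.
have C2 : Ck k setT (fun z : velocity R => z.2) :=
  @smooth_comp_snd R R R _ (@smooth_id R) k.
by apply: CkD => //; [apply: CkD => //; [exact: Ck_cst|exact: CkZ]|exact: CkZ].
Qed.

Lemma cutoff_compact : compact (supp kappa).
Proof.
have [_ cc _] := tchi; apply: (subclosed_compact (@supp_closed _ _ _) cc).
apply: supp_sub; first exact: supp_closed.
by move=> z; rewrite mulf_eq0 negb_or => /andP[_ /in_supp].
Qed.

Lemma cutoffE z : `|z| <= r -> kappa z = a0 + a1 * z.1 + a2 * z.2.
Proof. by move=> zr; rewrite /kappa chi1 // mulr1. Qed.

(** The strict bound leaves a neighbourhood of [z] on which [chi] is 1, so [chi] contributes nothing
    to the derivative. *)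
Lemma cutoff_derive v z : `|z| < r -> 'D_v kappa z = a1 * v.1 + a2 * v.2.
Proof.
move=> zr; rewrite (@near_eq_derive _ _ _ _ (fun z => a0 + a1 * z.1 + a2 * z.2));
  last first.
  have oB : open (ball (0 : velocity R) r) by exact: ball_open.
  have zB : ball (0 : velocity R) r z by rewrite -ball_normE /ball_ /= sub0r normrN.
  apply: (near_open oB zB) => y; rewrite -ball_normE /ball_ /= sub0r normrN => /ltW.
  exact: cutoffE.
have D1 : is_derive z v (fun z : velocity R => z.1) v.1.
  by apply: (@is_derive_affine _ _ _ _ fst fst (fun x : R => x)).
have D2 : is_derive z v (fun z : velocity R => z.2) v.2.
  by apply: (@is_derive_affine _ _ _ _ snd snd (fun x : R => x)).
have := is_deriveD (is_deriveD (is_derive_cst a0 z v) (is_deriveZ a1 D1)) (is_deriveZ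
  a2 D2).
by move=> [_]; rewrite add0r.
Qed.

(** [psi] and [kap] will be [phi] and [kappa] or their derivatives. Derivatives do not enlarge
    supports, so the single radius [r] attached to [phi] serves every term of the operator. *)
Lemma equilibrium_moment_cutoff (k0 k1 k2 k11 k12 k22 : R) (C psi : spacetime R -> R)
    (kp kap : velocity R -> R) (F : phase R -> R) :
  (forall q, F q = C q.1 * kp q.2 * equilibrium g h m w q) ->
  cont_on Omega C -> continuous kp -> test_function Omega psi ->
    supp psi `<=` supp phi ->
  smooth kap -> compact (supp kap) ->
  (forall z, `|z| < r -> kp z * kap z = k0 + k1 * z.1 + k2 * z.2 + k11 * z.1 ^+ 2
    + k12 * (z.1 * z.2) + k22 * z.2 ^+ 2) ->
  distr_of Omega F (fun q => psi q.1 * kap q.2) =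
  \int[leb3]_(p in Omega)
     (C p * (m p * (k0 + k1 * (w p).1 + k2 * (w p).2 + k11 * (w p).1 ^+ 2
    + k12 * ((w p).1 * (w p).2) + k22 * (w p).2 ^+ 2 + (k11 + k22) * (g * h p / 2))) *
        psi p).
Proof.
move=> /funext -> cC ckp tpsi spsi skap ckap Hk.
apply: (@equilibrium_moment R Omega Omega_open g h g_gt0 h_cont h_gt0 m w m_cont
  w_cont) => //.
by move=> p z /spsi sp /(wr sp); exact: Hk.
Qed.

Lemma equilibrium_moment1 :
  distr_of Omega (equilibrium g h m w) (fun q => phi q.1 * kappa q.2) =
  \int[leb3]_(p in Omega) ((m p * (a0 + a1 * (w p).1 + a2 * (w p).2)) * phi p).
Proof.
rewrite (@equilibrium_moment_cutoff a0 a1 a2 0 0 0 (fun=> 1) _ (fun=> 1) kappa) //.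
- by apply: eq_Rintegral => p _; ring.
- by move=> q; rewrite !mul1r.
- exact: cont_on_cst.
- by move=> z; exact: cvg_cst.
- exact: cutoff_smooth.
- exact: cutoff_compact.
- by move=> z zr; rewrite cutoffE ?(ltW zr) //; ring.
Qed.

End OneMoment.

Lemma derive_bottom_cont v : cont_on Omega ('D_v (Defs.bottom zb)).
Proof. exact: (Ck_continuous (Ck_derive v zb_C1)). Qed.

(* Fluxes of [a0 + a1 xi + a2 gamma] carried by [M_a]. *)
Definition flux_t a (a0 a1 a2 : R) p := a0 * H a p + a1 * (HU a p).1 + a2 * (HU a p).2.

Definition flux_x a (a0 a1 a2 : R) p := a0 * (HU a p).1
  + a1 * ((u a p).1 * (HU a p).1 + g / 2 * (h p * H a p)) + a2 * ((u a p).1 * (HU a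
      p).2).

Definition flux_y a (a0 a1 a2 : R) p := a0 * (HU a p).2
  + a1 * ((u a p).2 * (HU a p).1) + a2 * ((u a p).2 * (HU a p).2 + g / 2 * (h p * H a
      p)).

Section LayerMoment.
Variable a : nat.
Hypothesis aN : (1 <= a <= N)%N.

Let Ha_C1 : Ck 1 Omega (H a) := layer_depth_C1 l Omega_open h_C1 a.
Let ua_C1 : Ck 1 Omega (u a) := u_C1 aN.
Let Ha_cont := Ck_continuous Ha_C1.
Let ua_cont := Ck_continuous ua_C1.

Let HU1_C1 : Ck 1 Omega (fun p => (HU a p).1).
Proof. exact: (Ck_fst Omega_open (discharge_C1 l Omega_open h_C1 u_C1 aN)). Qed.

Let HU2_C1 : Ck 1 Omega (fun p => (HU a p).2).
Proof. exact: (Ck_snd Omega_open (discharge_C1 l Omega_open h_C1 u_C1 aN)). Qed.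

Let u1_C1 : Ck 1 Omega (fun p => (u a p).1).
Proof. exact: (Ck_fst Omega_open ua_C1). Qed.

Let u2_C1 : Ck 1 Omega (fun p => (u a p).2).
Proof. exact: (Ck_snd Omega_open ua_C1). Qed.

Let pr_C1 : Ck 1 Omega (fun p => g / 2 * (h p * H a p)).
Proof. exact: (CkZ (g / 2) Omega_open (CkM Omega_open h_C1 Ha_C1)). Qed.

Let lin3_C1 (a0 a1 a2 : R) (f0 f1 f2 : spacetime R -> R) :
  Ck 1 Omega f0 -> Ck 1 Omega f1 -> Ck 1 Omega f2 ->
  Ck 1 Omega (fun p => a0 * f0 p + a1 * f1 p + a2 * f2 p).
Proof.
move=> C0 C1 C2; have oO := Omega_open.
exact: (CkD oO (CkD oO (CkZ a0 oO C0) (CkZ a1 oO C1)) (CkZ a2 oO C2)).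
Qed.

Lemma flux_t_C1 a0 a1 a2 : Ck 1 Omega (flux_t a a0 a1 a2).
Proof. exact: (lin3_C1 a0 a1 a2 Ha_C1 HU1_C1 HU2_C1). Qed.

Lemma flux_x_C1 a0 a1 a2 : Ck 1 Omega (flux_x a a0 a1 a2).
Proof.
have oO := Omega_open.
exact: (lin3_C1 a0 a1 a2 HU1_C1 (CkD oO (CkM oO u1_C1 HU1_C1) pr_C1) (CkM oO u1_C1
  HU2_C1)).
Qed.

Lemma flux_y_C1 a0 a1 a2 : Ck 1 Omega (flux_y a a0 a1 a2).
Proof.
have oO := Omega_open.
exact: (lin3_C1 a0 a1 a2 HU2_C1 (CkM oO u2_C1 HU1_C1) (CkD oO (CkM oO u2_C1 HU2_C1)
  pr_C1)).
Qed.

Section Weighted.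
Variables (phi : spacetime R -> R) (chi : velocity R -> R) (r a0 a1 a2 : R).
Hypothesis tphi : test_function Omega phi.
Hypothesis tchi : test_function setT chi.
Hypothesis chi1 : forall z, `|z| <= r -> chi z = 1.
Hypothesis wr : forall p z, supp phi p -> equilibrium g h (H a) (u a) (p, z) != 0 ->
  `|z| < r.

Local Notation Phi := (fun q : phase R => phi q.1 * ((a0 + a1 * q.2.1 + a2 * q.2.2) *
  chi q.2)).
Let kappa (z : velocity R) : R := (a0 + a1 * z.1 + a2 * z.2) * chi z.

Let skappa : smooth kappa .
Proof. exact: cutoff_smooth. Qed.
Let ckappa : compact (supp kappa) .
Proof. exact: cutoff_compact. Qed.
Let kappaE z : `|z| <= r -> kappa z = a0 + a1 * z.1 + a2 * z.2 .
Proof. exact: cutoffE. Qed.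

Let moment := @equilibrium_moment_cutoff _ _ Ha_cont ua_cont phi r wr.

Let test_derive v := test_function_derive v tphi.

Lemma time_moment : distr_derive (e_t R, 0) (distr_of Omega (Meq g l h u a)) Phi =
  \int[leb3]_(p in Omega) ('D_(e_t R) (flux_t a a0 a1 a2) p * phi p).
Proof.
have [sphi _ _] := tphi.
rewrite /distr_derive (@derive_tensor1 _ _ _ phi kappa) //.
rewrite (moment (k0 := a0) (k1 := a1) (k2 := a2) (k11 := 0) (k12 := 0) (k22 := 0)
  (C := fun=> 1) (kp := fun=> 1) (psi := 'D_(e_t R) phi) (kap := kappa)) //.
- rewrite -[RHS]opprK -(integration_by_parts _ Omega_open (flux_t_C1 a0 a1 a2) tphi);
    last exact: Or31.
  by congr (- _); apply: eq_Rintegral => p _; rewrite /flux_t /discharge /=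
    /GRing.scale /=; ring.
- by move=> q; rewrite !mul1r.
- exact: cont_on_cst.
- by move=> z; exact: cvg_cst.
- exact: supp_derive.
- by move=> z zr; rewrite kappaE ?(ltW zr) //; ring.
Qed.

Lemma x_moment : distr_derive (e_x R, 0) (distr_of Omega (fun q =>
  q.2.1 * Meq g l h u a q)) Phi =
  \int[leb3]_(p in Omega) ('D_(e_x R) (flux_x a a0 a1 a2) p * phi p).
Proof.
have [sphi _ _] := tphi.
rewrite /distr_derive (@derive_tensor1 _ _ _ phi kappa) //.
(* These are the coefficients of xi (a0 + a1 xi + a2 gamma); the pressure in [flux_x] comes from the
   pure square, with coefficient [a1]. *)
rewrite (moment (k0 := 0) (k1 := a0) (k2 := 0) (k11 := a1) (k12 := a2) (k22 := 0)
  (C := fun=> 1) (kp := fst) (psi := 'D_(e_x R) phi) (kap := kappa)) //.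
- rewrite -[RHS]opprK -(integration_by_parts _ Omega_open (flux_x_C1 a0 a1 a2) tphi);
    last exact: Or32.
  by congr (- _); apply: eq_Rintegral => p _; rewrite /flux_x /discharge /=
    /GRing.scale /=; field.
- by move=> q; rewrite mul1r.
- exact: cont_on_cst.
- exact: fst_continuous.
- exact: supp_derive.
- by move=> z zr; rewrite kappaE ?(ltW zr) //; ring.
Qed.

Lemma y_moment : distr_derive (e_y R, 0) (distr_of Omega (fun q =>
  q.2.2 * Meq g l h u a q)) Phi =
  \int[leb3]_(p in Omega) ('D_(e_y R) (flux_y a a0 a1 a2) p * phi p).
Proof.
have [sphi _ _] := tphi.
rewrite /distr_derive (@derive_tensor1 _ _ _ phi kappa) //.
rewrite (moment (k0 := 0) (k1 := 0) (k2 := a0) (k11 := 0) (k12 := a1) (k22 := a2)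
  (C := fun=> 1) (kp := snd) (psi := 'D_(e_y R) phi) (kap := kappa)) //.
- rewrite -[RHS]opprK -(integration_by_parts _ Omega_open (flux_y_C1 a0 a1 a2) tphi);
    last exact: Or33.
  by congr (- _); apply: eq_Rintegral => p _; rewrite /flux_y /discharge /=
    /GRing.scale /=; field.
- by move=> q; rewrite mul1r.
- exact: cont_on_cst.
- exact: snd_continuous.
- exact: supp_derive.
- by move=> z zr; rewrite kappaE ?(ltW zr) //; ring.
Qed.

(** The velocity derivative falls on the affine weight and leaves the constant a1 v_1 + a2 v_2, so
    only the mass of the equilibrium survives; no derivative in space-time is involved. *)
Lemma force_moment (v : velocity R) (f : spacetime R -> R) : cont_on Omega f ->
  distr_derive (0, v) (distr_of Omega (fun q => g * f q.1 * Meq g l h u a q)) Phi =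
  - \int[leb3]_(p in Omega) (g * H a p * f p * (a1 * v.1 + a2 * v.2) * phi p).
Proof.
move=> cf.
rewrite /distr_derive (@derive_tensor2 _ _ _ phi kappa) //; congr (- _).
rewrite (moment (k0 := a1 * v.1 + a2 * v.2) (k1 := 0) (k2 := 0) (k11 := 0) (k12 :=
  0) (k22 := 0)
  (C := fun p => g * f p) (kp := fun=> 1) (psi := phi) (kap := 'D_v kappa)) //.
- by apply: eq_Rintegral => p _; ring.
- by move=> q; rewrite mulr1.
- by apply: cont_onM => //; exact: cont_on_cst.
- by move=> z; exact: cvg_cst.
- exact: smooth_derive.
- exact: subclosed_compact (@supp_closed _ _ _) ckappa (@supp_derive _ _ _ _).
- by move=> z zr; rewrite (cutoff_derive _ _ _ chi1) //; ring.
Qed.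

End Weighted.

(** The upwind choice switches only where the exchange changes sign, hence where the flux is 0;
    [upwind_split] turns this into a sum of products of continuous functions. *)
Lemma upwind_flux_cont b (a0 a1 a2 : R) : (b <= N)%N -> cont_on Omega
  (fun p => a0 * G b p + a1 * (G b p *: up b p).1 + a2 * (G b p *: up b p).2).
Proof.
move=> bN; have [m1 [m2 [w1 [w2 [[cm1 cm2 cw1 cw2] [_ GE GU]]]]]] :=
  upwind_split g l_sum Omega_open h_C1 u_C1 bN.
rewrite (_ : (fun p => _) = (fun p => a0 * (m1 p + m2 p)
  + a1 * (m1 p * (w1 p).1 + m2 p * (w2 p).1) + a2 * (m1 p * (w1 p).2 + m2 p * (w2
      p).2)));
  last by apply/funext => p; rewrite GU GE.
have cZ (c : R) (f : spacetime R -> R) : cont_on Omega f ->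
  cont_on Omega (fun p => c * f p).
  by move=> cf; exact: (cont_onM (@cont_on_cst _ _ Omega c) cf).
exact: (cont_onD (cont_onD (cZ a0 _ (cont_onD cm1 cm2))
  (cZ a1 _ (cont_onD (cont_onM cm1 (cont_on_fst cw1)) (cont_onM cm2 (cont_on_fst
    cw2)))))
  (cZ a2 _ (cont_onD (cont_onM cm1 (cont_on_snd cw1)) (cont_onM cm2 (cont_on_snd
    cw2))))).
Qed.

(** Any larger radius [r'] is allowed, so that one common radius can later be taken for both
    interfaces and for the layer itself. *)
Lemma exchange_moment b phi : (b <= N)%N -> test_function Omega phi ->
  exists r, forall r' chi a0 a1 a2, r <= r' -> test_function setT chi ->
  (forall z, `|z| <= r' -> chi z = 1) ->
  distr_of Omega (Neq g N l h u b)
    (fun q : phase R => phi q.1 * ((a0 + a1 * q.2.1 + a2 * q.2.2) * chi q.2)) =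
  \int[leb3]_(p in Omega)
    ((a0 * G b p + a1 * (G b p *: up b p).1 + a2 * (G b p *: up b p).2) * phi p).
Proof.
move=> bN tphi; have [_ cphi sphi] := tphi.
have [m1 [m2 [w1 [w2 [[cm1 cm2 cw1 cw2] [NE GE GU]]]]]] :=
  upwind_split g l_sum Omega_open h_C1 u_C1 bN.
have [r1 H1] := equilibrium_radius g_gt0 h_cont h_gt0 m1 cw1 cphi sphi.
have [r2 H2] := equilibrium_radius g_gt0 h_cont h_gt0 m2 cw2 cphi sphi.
exists (Num.max r1 r2) => r' chi a0 a1 a2; rewrite ge_max => /andP[r1r r2r] tchi chi1.
have tPhi : test_function (phase_domain Omega)
    (fun q : phase R => phi q.1 * ((a0 + a1 * q.2.1 + a2 * q.2.2) * chi q.2)).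
  apply: (test_function_tensor (g := fun z => (a0 + a1 * z.1 + a2 * z.2) * chi z) tphi).
  by split; [exact: cutoff_smooth|exact: cutoff_compact|exact: subsetT].
rewrite (_ : Neq g N l h u b = fun q => equilibrium g h m1 w1 q + equilibrium g h m2
  w2 q);
  last by apply/funext.
rewrite distr_ofD //; [|exact: equilibrium_locally_bounded..].
rewrite (@equilibrium_moment1 m1 w1 cm1 cw1 phi chi r' a0 a1 a2) //; last first.
  by move=> p z sp e0; apply: lt_le_trans r1r; exact: H1 sp e0.
rewrite (@equilibrium_moment1 m2 w2 cm2 cw2 phi chi r' a0 a1 a2) //; last first.
  by move=> p z sp e0; apply: lt_le_trans r2r; exact: H2 sp e0.
have cE (m : spacetime R -> R) (w : spacetime R -> velocity R) :
  cont_on Omega m -> cont_on Omega w ->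
    cont_on Omega (fun p => m p * (a0 + a1 * (w p).1 + a2 * (w p).2)).
  move=> cm cw; apply: cont_onM => //.
  apply: cont_onD; last by apply: cont_onM; [exact: cont_on_cst|exact: cont_on_snd].
  apply: cont_onD; first exact: cont_on_cst.
  by apply: cont_onM; [exact: cont_on_cst|exact: cont_on_fst].
rewrite -[X in _ + X]mul1r Rintegral_test_lin //; [|exact: cE..].
apply: eq_Rintegral => p _; rewrite GU GE /= /GRing.scale /=; ring.
Qed.

(** With derivatives abstracted into variables, all that remains is to collect the terms by weight
    [a0], [a1], [a2]. *)
Let residual_identity (a0 a1 a2 t0 t1 t2 x1 xx1 px x12 y2 y21 y22 py bx by_ k v1 v2 k'
  v1' v2' gh : R) :
  a0 * t0 + a1 * t1 + a2 * t2 + (a0 * x1 + a1 * (xx1 + px) + a2 * x12)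
    + (a0 * y2 + a1 * y21 + a2 * (y22 + py)) + gh * bx * a1 + gh * by_ * a2
    - (a0 * k + a1 * (k * v1) + a2 * (k * v2))
    + (a0 * k' + a1 * (k' * v1') + a2 * (k' * v2')) =
  a0 * (t0 + (x1 + y2) - (k - k'))
    + a1 * (t1 + (xx1 + y21) + px + gh * bx - (k * v1 - k' * v1'))
    + a2 * (t2 + (x12 + y22) + py + gh * by_ - (k * v2 - k' * v2')).
Proof. by ring. Qed.

Lemma weighted_residual (a0 a1 a2 : R) p : Omega p ->
  'D_(e_t R) (flux_t a a0 a1 a2) p + 'D_(e_x R) (flux_x a a0 a1 a2) p
    + 'D_(e_y R) (flux_y a a0 a1 a2) p
    + g * H a p * 'D_(e_x R) (Defs.bottom zb) p * a1
    + g * H a p * 'D_(e_y R) (Defs.bottom zb) p * a2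
    - (a0 * G a p + a1 * (G a p *: up a p).1 + a2 * (G a p *: up a p).2)
    + (a0 * G a.-1 p + a1 * (G a.-1 p *: up a.-1 p).1 + a2 * (G a.-1 p *:
        up a.-1 p).2) =
  a0 * mass_residual N l h u a p
    + a1 * (momentum_residual g N l zb h u a p).1
    + a2 * (momentum_residual g N l zb h u a p).2.
Proof.
move=> Op.
have oO := Omega_open.
have CHU := discharge_C1 l oO h_C1 u_C1 aN.
have C1 := Ck_fst oO CHU; have C2 := Ck_snd oO CHU.
have U1 := Ck_fst oO ua_C1; have U2 := Ck_snd oO ua_C1.
have CP := CkZ (g / 2) oO (CkM oO h_C1 Ha_C1).
have dD v f f' : Ck 1 Omega f -> Ck 1 Omega f' ->
    'D_v (fun p => f p + f' p) p = 'D_v f p + 'D_v f' p.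
  by move=> Cf Cf'; have [] := is_deriveD (Ck_is_derive v Cf Op) (Ck_is_derive v Cf'
    Op).
have C11 := CkM oO U1 C1; have C12 := CkM oO U1 C2.
have C21 := CkM oO U2 C1; have C22 := CkM oO U2 C2.
have CT1 := Ck_scale_pair oO U1 CHU; have CT2 := Ck_scale_pair oO U2 CHU.
rewrite /flux_t /flux_x /flux_y.
rewrite (is_derive_lin3 a0 a1 a2 _ Ha_C1 C1 C2 Op).
rewrite (is_derive_lin3 a0 a1 a2 _ C1 (CkD oO C11 CP) C12 Op).
rewrite (is_derive_lin3 a0 a1 a2 _ C2 C21 (CkD oO C22 CP) Op).
rewrite (dD _ _ _ _ C11 CP) (dD _ _ _ _ C22 CP).
rewrite /mass_residual /momentum_residual /div /div_tensor /grad /=.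
(* The momentum residual differentiates vector-valued fields while the fluxes differentiate their
   components; the two are matched one occurrence at a time. *)
rewrite [X in a1 * (X + _ + _ + _ - _)](derive_fst (e_t R) CHU Op).
rewrite [X in a2 * (X + _ + _ + _ - _)](derive_snd (e_t R) CHU Op).
rewrite [X in a1 * (_ + (X + _) + _ + _ - _)](derive_fst (e_x R) CT1 Op).
rewrite [X in a2 * (_ + (X + _) + _ + _ - _)](derive_snd (e_x R) CT1 Op).
rewrite [X in a1 * (_ + (_ + X) + _ + _ - _)](derive_fst (e_y R) CT2 Op).
rewrite [X in a2 * (_ + (_ + X) + _ + _ - _)](derive_snd (e_y R) CT2 Op).
exact: residual_identity.
Qed.

(** Continuity is read off the flux form given by [weighted_residual]: derivatives of C^1 fluxes and
    of the bottom, plus continuous exchange fluxes. That form agrees with the residual only on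
    [Omega], which is open, so continuity transfers. *)
Lemma residual_cont (a0 a1 a2 : R) : cont_on Omega
  (fun p => a0 * mass_residual N l h u a p
    + a1 * (momentum_residual g N l zb h u a p).1
    + a2 * (momentum_residual g N l zb h u a p).2).
Proof.
have dc v (f : spacetime R -> R) : Ck 1 Omega f -> cont_on Omega ('D_v f).
  by move=> Cf; exact: (Ck_continuous (Ck_derive v Cf)).
have cf v (b : R) : cont_on Omega (fun p => g * H a p * 'D_v (Defs.bottom zb) p * b).
  exact: (cont_onM (cont_onM (cont_onM (@cont_on_cst _ _ Omega g) Ha_cont)
    (@derive_bottom_cont v)) (@cont_on_cst _ _ Omega _)).
have aN' := (andP aN).2.
have c := cont_onD (cont_onB (cont_onD (cont_onD (cont_onD (cont_onD
  (dc (e_t R) _ (flux_t_C1 a0 a1 a2)) (dc (e_x R) _ (flux_x_C1 a0 a1 a2)))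
  (dc (e_y R) _ (flux_y_C1 a0 a1 a2))) (cf (e_x R) a1)) (cf (e_y R) a2))
  (@upwind_flux_cont a a0 a1 a2 aN'))
  (@upwind_flux_cont a.-1 a0 a1 a2 (leq_trans (leq_pred a) aN')).
move=> p Op; apply: near_continuous (c p Op); apply: (near_open Omega_open Op) => y Oy.
exact: (weighted_residual a0 a1 a2 Oy).
Qed.

(** The radius is fixed before the cutoff and the weights are chosen, as in the definition of
    [velocity_moment]. *)
Lemma kinetic_moment phi : test_function Omega phi ->
  exists r, forall chi a0 a1 a2, test_function setT chi ->
  (forall z, `|z| <= r -> chi z = 1) ->
  kinetic_operator g N l zb Omega h u a
    (fun q : phase R => phi q.1 * ((a0 + a1 * q.2.1 + a2 * q.2.2) * chi q.2)) =
  \int[leb3]_(p in Omega) ((a0 * mass_residual N l h u a p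
    + a1 * (momentum_residual g N l zb h u a p).1
    + a2 * (momentum_residual g N l zb h u a p).2) * phi p).
Proof.
move=> tphi; have [_ cphi sphi] := tphi.
have [r1 H1] := equilibrium_radius g_gt0 h_cont h_gt0 (H a) ua_cont cphi sphi.
have [r2 H2] := exchange_moment (andP aN).2 tphi.
have [r3 H3] := exchange_moment (leq_trans (leq_pred a) (andP aN).2) tphi.
exists (Num.max r1 (Num.max r2 r3)) => chi a0 a1 a2 tchi.
set r := Num.max _ _ => chi1.
have r1r : r1 <= r by rewrite le_max lexx.
have r2r : r2 <= r by rewrite !le_max lexx orbT.
have r3r : r3 <= r by rewrite !le_max lexx !orbT.
have wr p z : supp phi p -> equilibrium g h (H a) (u a) (p, z) != 0 -> `|z| < r.
  by move=> sp e0; apply: lt_le_trans r1r; exact: H1 sp e0.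
rewrite /kinetic_operator (H2 r) // (H3 r) //.
rewrite (time_moment _ _ _ tphi tchi chi1 wr) (x_moment _ _ _ tphi tchi chi1 wr)
  (y_moment _ _ _ tphi tchi chi1 wr).
rewrite (force_moment _ _ _ tphi tchi chi1 wr _ (@derive_bottom_cont (e_x R))).
rewrite (force_moment _ _ _ tphi tchi chi1 wr _ (@derive_bottom_cont (e_y R))).
have dc v (f : spacetime R -> R) : Ck 1 Omega f -> cont_on Omega ('D_v f).
  by move=> Cf; exact: (Ck_continuous (Ck_derive v Cf)).
have ct := dc (e_t R) _ (flux_t_C1 a0 a1 a2).
have cx := dc (e_x R) _ (flux_x_C1 a0 a1 a2).
have cy := dc (e_y R) _ (flux_y_C1 a0 a1 a2).
have cf v (w : velocity R) : cont_on Omega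
    (fun p => g * H a p * 'D_v (Defs.bottom zb) p * (a1 * w.1 + a2 * w.2)).
  exact: (cont_onM (cont_onM (cont_onM (@cont_on_cst _ _ Omega g) Ha_cont)
    (@derive_bottom_cont v)) (@cont_on_cst _ _ Omega _)).
have ce b : (b <= N)%N -> _ := @upwind_flux_cont b a0 a1 a2.
have aN' := (andP aN).2.
have aN1 : (a.-1 <= N)%N := leq_trans (leq_pred a) aN'.
rewrite !opprK (Rintegral_testD Omega_open ct cx tphi).
have c2 := cont_onD ct cx; rewrite (Rintegral_testD Omega_open c2 cy tphi).
have c3 := cont_onD c2 cy; rewrite (Rintegral_testD Omega_open c3 (cf _ _) tphi).
have c4 := cont_onD c3 (cf (e_x R) (e_xi R)).
rewrite (Rintegral_testD Omega_open c4 (cf _ _) tphi).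
have c5 := cont_onD c4 (cf (e_y R) (e_gamma R)).
rewrite (Rintegral_testB Omega_open c5 (ce _ aN') tphi).
have c6 := cont_onB c5 (ce _ aN'); rewrite (Rintegral_testD Omega_open c6 (ce _ aN1)
  tphi).
apply: eq_Rintegral => p; rewrite inE => Op; congr (_ * _).
rewrite -(weighted_residual a0 a1 a2 Op) /= !mulr1 !mulr0 addr0 add0r.
by [].
Qed.

End LayerMoment.
End KineticMoments.

(** * The kinetic operator is a distribution *)

Section OrderOne.
Variable R : realType.
Implicit Types V : normedModType R.

(** Distributions of order at most one, in a form stable under sums: both terms are estimated by the
    same [B], and the constants add up. *)
Definition order1_on V (D : set V) (T : (V -> R) -> R) :=
  (forall (a : R) (phi psi : V -> R), test_function D phi -> test_function D psi ->
     T (fun x => a * phi x + psi x) = a * T phi + T psi) /\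
  (forall K : set V, compact K -> K `<=` D ->
     exists C : R, 0 <= C /\ forall (phi : V -> R) (B : R),
       test_function D phi -> supp phi `<=` K ->
       (forall x, `|phi x| <= B) ->
       (forall v x, `|v| <= 1 -> `|'D_v phi x| <= B) -> `|T phi| <= C * B).

Lemma order1_distribution V (D : set V) T : order1_on D T -> distribution_on D T.
Proof.
move=> [lT bT]; split=> // K cK KD; have [C [_ HC]] := bT K cK KD.
exists 1%N, C => phi B tphi sK HB; apply: HC => // [x|v x v1].
  by apply: (HB [::]) => // v; rewrite in_nil.
by apply: (HB [:: v]) => // w; rewrite inE => /eqP ->.
Qed.

Lemma order1D V (D : set V) T T' : order1_on D T -> order1_on D T' ->
  order1_on D (fun phi => T phi + T' phi).
Proof.
move=> [lT bT] [lT' bT']; split=> [a phi psi tphi tpsi|K cK KD].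
  by rewrite lT // lT' //; ring.
have [C [C0 HC]] := bT K cK KD; have [C' [C0' HC']] := bT' K cK KD.
exists (C + C'); split=> [|phi B tphi sK B1 B2]; first exact: addr_ge0.
by rewrite (le_trans (ler_normD _ _)) // mulrDl lerD // ?HC ?HC'.
Qed.

Lemma order1N V (D : set V) T : order1_on D T -> order1_on D (fun phi => - T phi).
Proof.
move=> [lT bT]; split=> [a phi psi tphi tpsi|K cK KD]; first by rewrite lT //; ring.
have [C [C0 HC]] := bT K cK KD; exists C; split=> // phi B tphi sK B1 B2.
by rewrite normrN HC.
Qed.

End OrderOne.

Section OrderOneIntegral.
Variable R : realType.
Local Notation mR := (measurableTypeR R).
Variable Omega : set (spacetime R).
Hypothesis Omega_open : open Omega.
Local Notation D := (phase_domain Omega).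

Lemma distr_of_linear (F : phase R -> R) (a : R) phi psi : locally_bounded_on Omega F ->
  test_function D phi -> test_function D psi ->
  distr_of Omega F (fun x => a * phi x + psi x) = a * distr_of Omega F phi + distr_of
    Omega F psi.
Proof.
move=> LF tphi tpsi; have [sp cp Dp] := tphi; have [sq cq Dq] := tpsi.
have ip := locally_bounded_integrable Omega_open LF (smooth_continuous sp) cp Dp.
have iq := locally_bounded_integrable Omega_open LF (smooth_continuous sq) cq Dq.
rewrite (distr_ofE _ Dp) (distr_ofE _ Dq) /distr_of Rintegral_supp; last first.
  by move=> q nDq; rewrite (test_function_out tphi nDq) (test_function_out tpsi nDq);
    ring.
rewrite -RintegralZl // -RintegralD //; last exact: (integrableZl measurableT a ip).
by congr Rintegral; apply/funext => q; ring.
Qed.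

Lemma distr_of_bound (F : phase R -> R) (K : set (phase R)) :
  locally_bounded_on Omega F ->
  compact K -> K `<=` D -> exists C, 0 <= C /\ forall phi B, test_function D phi ->
  supp phi `<=` K -> (forall x, `|phi x| <= B) -> `|distr_of Omega F phi| <= C * B.
Proof.
move=> LF cK KD.
have [M HM] := LF.2 K cK KD.
have [r Kr] := compact_in_boxes cK.
pose X := box3 r `*` box2 r.
have mX : measurable (X : set ((mR * (mR * mR)) * (mR * mR))).
  by apply: measurableX; [exact: measurable_box3|exact: measurable_box2].
have Xfin : (leb5 R X < +oo)%E by exact: box5_fin.
(* A bound of [F] on [K] times the volume of a box containing [K]. *)
exists (`|M| * fine (leb5 R X)); split; first by rewrite mulr_ge0 // fine_ge0.
move=> phi B tphi sK HB; have [sp cp Dp] := tphi.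
have iF := locally_bounded_integrable Omega_open LF (smooth_continuous sp) cp Dp.
have B0 : 0 <= B by apply: le_trans (HB point); exact: normr_ge0.
have FB q : `|F q * phi q| <= `|M| * B.
  have [sq|nsq] := pselect (supp phi q); last first.
    by rewrite (notin_supp nsq) mulr0 normr0 mulr_ge0.
  by rewrite normrM ler_pM // (le_trans (HM q (sK _ sq))) // ler_norm.
have iX : (leb5 R).-integrable X (EFin \o (fun q => F q * phi q)).
  exact: (integrableS measurableT mX (@subsetT _ _) iF).
have outX q : ~ X q -> F q * phi q = 0.
  by move=> nXq; rewrite (@notin_supp _ _ phi) ?mulr0 // => /sK/Kr.
rewrite (distr_ofE _ Dp) -(Rintegral_supp (leb5 R) outX).
apply: (le_trans (le_normr_Rintegral mX iX)).
apply: (@le_trans _ _ (\int[leb5 R]_(q in X) (`|M| * B))).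
  apply: le_Rintegral => //.
  - exact: integrable_norm.
  - apply: measurable_bounded_integrable => //; exists (`|M| * B).
    split=> [|y My x _ /=]; first exact: num_real.
    by rewrite ger0_norm ?mulr_ge0 // ltW.
by rewrite Rintegral_cst // mulrAC.
Qed.

Lemma distr_of_order1 F : locally_bounded_on Omega F -> order1_on D (distr_of Omega F).
Proof.
move=> LF; split=> [a phi psi tphi tpsi|K cK KD]; first exact: distr_of_linear.
have [C [C0 HC]] := distr_of_bound LF cK KD.
by exists C; split=> // phi B tphi sK HB _; exact: HC.
Qed.

(** The seminorms only see directions in the unit ball; the five coordinate directions of phase
    space have sup norm 1. *)
Lemma distr_derive_order1 F v : `|v| <= 1 -> locally_bounded_on Omega F ->
  order1_on D (distr_derive v (distr_of Omega F)).
Proof.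
move=> v1 LF; split=> [a phi psi tphi tpsi|K cK KD].
  have [sp _ _] := tphi; have [sq _ _] := tpsi.
  rewrite /distr_derive (_ : 'D_v (fun x => _) = fun x => a * 'D_v phi x + 'D_v psi x).
    rewrite (distr_of_linear a LF (test_function_derive v tphi) (test_function_derive
      v tpsi)).
    by ring.
  apply/funext => x.
  by have [] := is_deriveD (is_deriveZ a (smooth_is_derive v x sp)) (smooth_is_derive
    v x sq).
have [C [C0 HC]] := distr_of_bound LF cK KD.
exists C; split=> // phi B tphi sK _ HB; rewrite /distr_derive normrN.
apply: HC; [exact: test_function_derive|exact: subset_trans (@supp_derive _ _ _ _) sK|].
by move=> x; exact: HB.
Qed.

End OrderOneIntegral.

Section KineticDistribution.
Variables (R : realType) (g : R) (N : nat) (l : nat -> R).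
Variables (zb : R * R -> R) (Omega : set (spacetime R)).
Variables (h : spacetime R -> R) (u : nat -> spacetime R -> velocity R).
Hypothesis g_gt0 : 0 < g.
Hypothesis l_sum : \sum_(1 <= a < N.+1) l a = 1.
Hypothesis Omega_open : open Omega.
Hypothesis zb_C1 : Ck 1 Omega (fun p : spacetime R => zb p.2).
Hypothesis h_C1 : Ck 1 Omega h.
Hypothesis u_C1 : forall a, (1 <= a <= N)%N -> Ck 1 Omega (u a).
Hypothesis h_gt0 : forall p, Omega p -> 0 < h p.

Lemma kinetic_operator_distribution a : (1 <= a <= N)%N ->
  distribution_on (phase_domain Omega) (kinetic_operator g N l zb Omega h u a).
Proof.
move=> aN; apply: order1_distribution.
have h_cont : cont_on Omega h := Ck_continuous h_C1.
have LM : locally_bounded_on Omega (Meq g l h u a).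
  apply: equilibrium_locally_bounded => //.
    exact: (Ck_continuous (layer_depth_C1 l Omega_open h_C1 a)).
  exact: (Ck_continuous (u_C1 aN)).
have LN b : (b <= N)%N -> locally_bounded_on Omega (Neq g N l h u b).
  move=> bN; have [m1 [m2 [w1 [w2 [[cm1 cm2 cw1 cw2] [NE _ _]]]]]] :=
    upwind_split g l_sum Omega_open h_C1 u_C1 bN.
  rewrite (_ : Neq g N l h u b = fun q => equilibrium g h m1 w1 q + equilibrium g h m2
    w2 q);
    last by apply/funext.
  by apply: locally_boundedD; exact: equilibrium_locally_bounded.
have L1 : locally_bounded_on Omega (fun q => q.2.1 * Meq g l h u a q).
  apply: (locally_boundedM _ LM); apply: cont_on_locally_bounded => //.
  exact: (cont_on_phase2 (@fst_continuous _ _)).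
have L2 : locally_bounded_on Omega (fun q => q.2.2 * Meq g l h u a q).
  apply: (locally_boundedM _ LM); apply: cont_on_locally_bounded => //.
  exact: (cont_on_phase2 (@snd_continuous _ _)).
have Lb v : locally_bounded_on Omega (fun q => g * 'D_v (Defs.bottom zb) q.1 * Meq g l
  h u a q).
  apply: (locally_boundedM _ LM); apply: cont_on_locally_bounded => //.
  apply: cont_onM; first exact: cont_on_cst.
  exact: (cont_on_phase1 (Ck_continuous (Ck_derive v zb_C1))).
rewrite /kinetic_operator /=.
have n1 : `|((e_t R, 0) : phase R)| <= 1 by rewrite !prod_norm_le /= normr1 normr0
  lexx ler01.
have n2 : `|((e_x R, 0) : phase R)| <= 1 by rewrite !prod_norm_le /= normr1 normr0
  lexx ler01.
have n3 : `|((e_y R, 0) : phase R)| <= 1 by rewrite !prod_norm_le /= normr1 normr0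
  lexx ler01.
have n4 : `|((0, e_xi R) : phase R)| <= 1 by rewrite !prod_norm_le /= normr1 normr0
  lexx ler01.
have n5 : `|((0, e_gamma R) : phase R)| <= 1 by rewrite !prod_norm_le /= normr1 normr0
  lexx ler01.
apply: order1D; last by apply: distr_of_order1 => //; apply: LN; case/andP: aN => _;
  exact/leq_trans/leq_pred.
apply: order1D; last by apply/order1N/distr_of_order1 => //; apply: LN; case/andP: aN.
apply: order1D; last by apply/order1N/distr_derive_order1.
apply: order1D; last by apply/order1N/distr_derive_order1.
by apply: order1D; [apply: order1D|]; apply: distr_derive_order1.
Qed.

End KineticDistribution.

(** * The fundamental lemma of the calculus of variations *)

Section FundamentalLemma.
Variable R : realType.
Local Notation mR := (measurableTypeR R).
Local Notation leb1 := (@lebesgue_measure R).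

(** The plateau of radius 1 rescaled by 2/d: it is 1 within d/2 of [x0] and 0 at distance at least
    d. The expanded affine argument is the form that [smooth_affine] takes. *)
Definition bump1 (x0 d x : R) : R := plateau 1 (- (2 / d * x0) + 2 / d * x).

Lemma bump1E x0 d x : bump1 x0 d x = plateau 1 (2 / d * (x - x0)).
Proof. by congr plateau; ring. Qed.

Lemma bump1_test (x0 d : R) : 0 < d -> test_function `[x0 - d, x0 + d]%classic (bump1
  x0 d).
Proof.
move=> d0.
have sI : supp (bump1 x0 d) `<=` `[x0 - d, x0 + d]%classic.
  apply: supp_sub; first exact: interval_closed.
  move=> x; rewrite bump1E; apply: contra_neqP;
    rewrite /= in_itv /= -ler_distl => /negP.
  rewrite -ltNge => dx; apply: plateau0.
  rewrite normrM gtr0_norm ?divr_gt0 // mulrAC ler_pdivlMr //.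
  by rewrite -[1 + 1]/2%:R ler_pM2l // ltW.
split=> //; first exact/smooth_affine/smooth_plateau.
exact: subclosed_compact (@supp_closed _ _ _) (@segment_compact _ _ _) sI.
Qed.

Lemma bump1_ge0 x0 d x : 0 <= bump1 x0 d x.
Proof. exact: plateau_ge0. Qed.

Lemma bump1_eq1 x0 d x : 0 < d -> `|x - x0| <= d / 2 -> bump1 x0 d x = 1.
Proof.
move=> d0 xd; rewrite bump1E plateau1 // normrM gtr0_norm ?divr_gt0 //.
by rewrite mulrAC ler_pdivrMr // mul1r mulrC -ler_pdivlMr.
Qed.

Definition bump (p0 : spacetime R) (d : R) (p : spacetime R) : R :=
  bump1 p0.1 d p.1 * (bump1 p0.2.1 d p.2.1 * bump1 p0.2.2 d p.2.2).

Lemma bump_test (D : set (spacetime R)) p0 d : 0 < d ->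
  (forall p, `|p - p0| <= d -> D p) -> test_function D (bump p0 d).
Proof.
move=> d0 dD.
have t2 := test_function_tensor (bump1_test p0.2.1 d0) (bump1_test p0.2.2 d0).
have [sb cb Db] := test_function_tensor (bump1_test p0.1 d0) t2.
split=> // p /Db [/=]; rewrite in_itv /= -ler_distl => p1 [/=].
rewrite !in_itv /= -!ler_distl => p2 p3; apply: dD.
by rewrite !prod_norm_le /= p1 p2 p3.
Qed.

Lemma bump_ge0 p0 d p : 0 <= bump p0 d p.
Proof. by rewrite mulr_ge0 ?bump1_ge0 // mulr_ge0 ?bump1_ge0. Qed.

Lemma bump_eq1 p0 d p : 0 < d -> `|p - p0| <= d / 2 -> bump p0 d p = 1.
Proof.
move=> d0; rewrite !prod_norm_le /= => /andP[p1 /andP[p2 p3]].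
by rewrite /bump !bump1_eq1 // !mulr1.
Qed.

(** Near [p0] the function stays above half its value there, so its product with a bump dominates
    [E p0 / 2] times the indicator of the box [B], of side [d] and measure d^3. *)
Lemma fundamental_lemma_pos (D : set (spacetime R)) (E : spacetime R -> R) p0 :
  open D -> cont_on D E -> D p0 -> 0 < E p0 ->
  exists2 phi, test_function D phi & 0 < \int[leb3 R]_(p in D) (E p * phi p).
Proof.
move=> oD cE Dp0 Ep0.
have : \forall p \near p0, D p /\ E p0 / 2 < E p.
  apply: filterI; first exact: open_nbhs_nbhs.
  apply: (cE p0 Dp0 [set y | E p0 / 2 < y]); apply: open_nbhs_nbhs.
  split; first exact: open_gt.
  by rewrite /= ltr_pdivrMr // ltr_pMr // ltr1n.
(* Halving [e] puts the closed ball of radius [d], which contains the support of the bump, inside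
   the open ball of radius [e]. *)
move=> /nbhs_ballP [e /= e0 He]; pose d := e / 2.
have d0 : 0 < d by rewrite divr_gt0.
have Hd p : `|p - p0| <= d -> D p /\ E p0 / 2 < E p.
  move=> pd; apply: He; rewrite -ball_normE /ball_ /= distrC (le_lt_trans pd) //.
  by rewrite ltr_pdivrMr // ltr_pMr // ltr1n.
have tb : test_function D (bump p0 d) by apply: bump_test => // p /Hd[].
exists (bump p0 d) => //.
pose I x : set R := `[x - d / 2, x + d / 2]%classic.
pose B : set (spacetime R) := I p0.1 `*` (I p0.2.1 `*` I p0.2.2).
have BP p : B p -> `|p - p0| <= d / 2.
  rewrite /B /I => -[/=]; rewrite in_itv /= -ler_distl => p1 [/=].
  rewrite !in_itv /= -!ler_distl => p2 p3.
  by rewrite !prod_norm_le /= p1 p2 p3.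
have mI x : measurable (I x : set mR) by exact: measurable_itv.
have leI x : leb1 (I x) = d%:E.
  rewrite /I lebesgue_measure_itv /= lte_fin ltrD2l gtrN ?divr_gt0 //.
  by rewrite -EFinD; congr EFin; field.
have mB : measurable (B : set (mR * (mR * mR))).
  by apply: measurableX => //; exact: measurableX.
have leB : leb3 R B = (d * (d * d))%:E.
  have leB2 : leb2 R (I p0.2.1 `*` I p0.2.2) = (d * d)%:E.
    transitivity (leb1 (I p0.2.1) * leb1 (I p0.2.2))%E; last by rewrite !leI -EFinM.
    exact: sf_prodX.
  transitivity (leb1 (I p0.1) * leb2 R (I p0.2.1 `*` I p0.2.2))%E.
    by apply: sf_prodX => //; exact: measurableX.
  by rewrite leI leB2 -EFinM.
have leBfin : (leb3 R B < +oo)%E by rewrite leB ltry.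
have outD p : ~ D p -> E p * bump p0 d p = 0.
  by move=> /(test_function_out tb) ->; rewrite mulr0.
rewrite (Rintegral_supp (leb3 R) outD).
have iE := Cc_integrable3 (test_function_Cc oD cE tb).
have iB : (leb3 R).-integrable setT (EFin \o ((fun=> E p0 / 2) \_ B)).
  apply: (@bounded_support_integrable _ (mR * (mR * mR))%type R (leb3 R) B _ (E p0 /
    2)) => //.
  - by apply/(measurable_restrictT _ mB); exact: measurable_cst.
  - move=> p; rewrite patchE; case: ifP => _; last by rewrite normr0 divr_ge0 // ltW.
    by rewrite ger0_norm // divr_ge0 // ltW.
  - by move=> p nBp; rewrite patchE memNset.
apply: (@lt_le_trans _ _ (\int[leb3 R]_p ((fun=> E p0 / 2) \_ B) p)).
  have -> : \int[leb3 R]_p ((fun=> E p0 / 2) \_ B) p = E p0 / 2 * fine (leb3 R B).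
    by rewrite -Rintegral_mkcond; exact: Rintegral_cst.
  by rewrite leB /= mulr_gt0 ?divr_gt0 // mulr_gt0 // mulr_gt0.
apply: le_Rintegral => // p _; rewrite patchE; case: ifPn => [|_].
  rewrite inE => /BP pB; rewrite bump_eq1 // mulr1 ltW //.
  apply: (Hd p _).2; apply: (le_trans pB).
  by rewrite ler_pdivrMr // ler_pMr // ler1n.
have [sp|nsp] := pselect (`|p - p0| <= d); last first.
  have tB : test_function [set p | `|p - p0| <= d] (bump p0 d) by exact: bump_test.
  by rewrite (test_function_out tB nsp) mulr0.
by rewrite mulr_ge0 ?bump_ge0 // ltW // (lt_trans _ (Hd p sp).2) // divr_gt0.
Qed.

End FundamentalLemma.

Section CalculusOfVariations.
Variable R : realType.
Local Notation mR := (measurableTypeR R).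

Lemma fundamental_lemma (D : set (spacetime R)) (E : spacetime R -> R) :
  open D -> cont_on D E ->
  (forall phi, test_function D phi -> \int[leb3 R]_(p in D) (E p * phi p) = 0) ->
  forall p, D p -> E p = 0.
Proof.
move=> oD cE E0 p Dp; apply/eqP/negPn/negP; rewrite neq_lt => /orP[Ep|Ep]; last first.
  have [phi tphi] := fundamental_lemma_pos oD cE Dp Ep.
  by rewrite (E0 phi tphi) ltxx.
have cN : cont_on D (fun p => 0 - E p).
  exact: (cont_onB (@cont_on_cst _ _ D 0) cE).
have Np : 0 < 0 - E p by rewrite sub0r oppr_gt0.
have [phi tphi] := fundamental_lemma_pos oD cN Dp Np.
rewrite -(Rintegral_testB oD (@cont_on_cst _ _ D 0) cE tphi) (E0 phi tphi) subr0.
rewrite Rintegral_eq0 ?ltxx // => q _.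
by rewrite mul0r.
Qed.

Definition cutoff (r : R) (z : velocity R) : R := plateau r z.1 * plateau r z.2.

Lemma plateau_test (r : R) : test_function (setT : set R) (plateau r).
Proof.
have sI : supp (plateau r) `<=` `[- (r + 1), r + 1]%classic.
  apply: supp_sub; first exact: interval_closed.
  move=> x; apply: contra_neqP; rewrite /= in_itv /= -ler_norml => /negP.
  by rewrite -ltNge => rx; apply: plateau0; exact: ltW.
split=> //; first exact: smooth_plateau.
exact: subclosed_compact (@supp_closed _ _ _) (@segment_compact _ _ _) sI.
Qed.

Lemma cutoff_test (r : R) : test_function (setT : set (velocity R)) (cutoff r).
Proof. by rewrite -setXTT; exact: test_function_tensor (plateau_test r) (plateau_test
  r). Qed.

Lemma cutoff_eq1 r z : `|z| <= r -> cutoff r z = 1.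
Proof.
by rewrite prod_norm_le => /andP[z1 z2]; rewrite /cutoff !plateau1 // mulr1.
Qed.

Lemma closed_measurable3 (K : set (spacetime R)) :
  closed K -> measurable (K : set (mR * (mR * mR))).
Proof.
move=> cK; rewrite -(setCK K); apply: measurableC.
by apply: open_measurable3; exact: closed_openC.
Qed.

Lemma Rintegral_ae_zero (D : set (spacetime R)) (m phi : spacetime R -> R) : open D ->
  locally_integrable_on D m -> {ae leb3 R, forall p, D p -> m p = 0} ->
  test_function D phi -> \int[leb3 R]_(p in D) (m p * phi p) = 0.
Proof.
move=> oD im m0 tphi; have [sphi cphi Dphi] := tphi.
have iK := im _ cphi Dphi.
have mK := closed_measurable3 (@supp_closed _ _ phi).
have outD p : ~ D p -> m p * phi p = 0.
  by move=> /(test_function_out tphi) ->; rewrite mulr0.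
have outK p : ~ supp phi p -> m p * phi p = 0 by move=> /notin_supp ->; rewrite mulr0.
(* Local integrability gives measurability of [m] on compact subsets of [D], so the domain is shrunk
   to [supp phi] before [m] is replaced by 0 almost everywhere. *)
rewrite (Rintegral_supp (leb3 R) outD) -(Rintegral_supp (leb3 R) outK).
rewrite /Rintegral (@ae_eq_integral _ _ _ (leb3 R) (supp phi) (cst 0%E)) //.
- by rewrite integral0.
- apply/measurable_EFinP; apply: measurable_funM.
    by apply/measurable_EFinP; exact: (measurable_int _ iK).
  apply: (measurable_funS measurableT (@subsetT _ _)).
  by apply: continuous_measurable3; [exact: openT|move=> x _; exact: smooth_continuous].
- by apply: (@filterS _ _ (ae_filter_ringOfSetsType (leb3 R)) _ _ _ m0) =>
    p m0p /Dphi /m0p /= ->; rewrite mul0r.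
Qed.

End CalculusOfVariations.

(** * Recovering the layer velocities from the layered field *)

Section LayeredVelocity.
Variables (R : realType) (N : nat) (l : nat -> R) (zb : R * R -> R).
Variables (h : spacetime R -> R).
Hypothesis l_gt0 : forall a, (1 <= a <= N)%N -> 0 < l a.

Lemma interface_step a p :
  interface l zb h a.+1 p = interface l zb h a p + l a.+1 * h p.
Proof. by rewrite /interface big_nat_recr //= addrA. Qed.

Lemma interface_le a b p : 0 < h p -> (a <= b)%N -> (b <= N)%N ->
  interface l zb h a p <= interface l zb h b p.
Proof.
move=> hp; elim: b => [|b IH]; first by rewrite leqn0 => /eqP ->.
rewrite leq_eqVlt ltnS => /orP[/eqP -> //|ab] bN.
apply: (le_trans (IH ab (ltnW bN))).
by rewrite interface_step lerDl mulr_ge0 // ltW // l_gt0.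
Qed.

(** The closed layers share their interfaces, where the field is a sum of two velocities. At the
    midpoint of a layer exactly one indicator is 1, because every layer has positive thickness. *)
Lemma layered_velocityE (u : nat -> spacetime R -> velocity R) a p :
  (1 <= a <= N)%N -> 0 < h p ->
  layered_velocity N l zb h u p ((interface l zb h a.-1 p + interface l zb h a p) / 2)
    = u a p.
Proof.
case: a => [//|a] /= aN hp; rewrite /layered_velocity.
set z := (_ + _) / 2.
have step := interface_step a p.
have lp : 0 < l a.+1 * h p by rewrite mulr_gt0 // l_gt0.
have z1 : interface l zb h a p < z by rewrite /z; lra.
have z2 : z < interface l zb h a.+1 p by rewrite /z; lra.
rewrite (bigD1_seq a.+1) ?iota_uniq //=; last by rewrite mem_index_iota ltnS.
rewrite (ltW z1) (ltW z2) scale1r big_nat_cond big1 ?addr0 // => b.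
rewrite ltnS => /andP[/andP[b1 bN] ba]; case: leP => [zb1|_]; last by rewrite scale0r.
rewrite andTb; case: leP => [zb2|_]; last by rewrite scale0r.
(* Another layer containing the midpoint would have its upper interface at or below the bottom of
   this layer, or its lower interface at or above the top; both contradict the strict position of
   the midpoint. *)
exfalso; move: ba; rewrite neq_ltn => /orP[ba|ab].
  have := interface_le hp (ba : (b <= a)%N) (ltnW aN); rewrite leNgt => /negP; apply.
  exact: lt_le_trans z1 zb2.
have ab' : (a.+1 <= b.-1)%N by rewrite -ltnS prednK.
have := interface_le hp ab' (leq_trans (leq_pred b) bN); rewrite leNgt => /negP; apply.
exact: le_lt_trans zb1 z2.
Qed.

End LayeredVelocity.

(** * The equivalence *)

Section Equivalence.
Variables (R : realType) (g : R) (N : nat) (l : nat -> R).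
Variables (zb : R * R -> R) (Omega : set (spacetime R)) (h : spacetime R -> R).
Hypothesis g_gt0 : 0 < g.
Hypothesis l_gt0 : forall a, (1 <= a <= N)%N -> 0 < l a.
Hypothesis l_sum : \sum_(1 <= a < N.+1) l a = 1.
Hypothesis Omega_open : open Omega.
Hypothesis zb_C1 : Ck 1 Omega (fun p : spacetime R => zb p.2).
Hypothesis h_C1 : Ck 1 Omega h.
Hypothesis h_gt0 : forall p, Omega p -> 0 < h p.

Lemma N_gt0 : (0 < N)%N.
Proof.
rewrite lt0n; apply/eqP => N0; move: l_sum; rewrite N0 big_geq // => /eqP.
by rewrite eq_sym oner_eq0.
Qed.

Section Locality.
Variables u u' : nat -> spacetime R -> velocity R.
Hypothesis uu' : forall a p, (1 <= a <= N)%N -> Omega p -> u a p = u' a p.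

Let dE (W : normedModType R) (f f' : spacetime R -> W) v p :
  Omega p -> (forall q, Omega q -> f q = f' q) -> 'D_v f p = 'D_v f' p.
Proof. by move=> Op ff'; apply: near_eq_derive;
  exact: (near_open Omega_open Op ff'). Qed.

Let dischargeE a q : (1 <= a <= N)%N -> Omega q ->
  discharge l h u a q = discharge l h u' a q.
Proof. by move=> aN Oq; rewrite /discharge uu'. Qed.

Let divE a p : (1 <= a <= N)%N -> Omega p ->
  div (discharge l h u a) p = div (discharge l h u' a) p.
Proof.
by move=> aN Op; congr (_ + _); apply: dE => // q Oq; rewrite dischargeE.
Qed.

Let exchangeE a p : Omega p -> exchange N l h u a p = exchange N l h u' a p.
Proof.
by move=> Op; congr (- _); apply: eq_big_nat => j jN; rewrite divE.
Qed.

(** The two families agree only for indices 1 to [N], so [upwind] itself may differ at the bottom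
    interface; its product with the exchange cannot. *)
Let upwindE a p : (a <= N)%N -> Omega p ->
  exchange N l h u a p *: upwind N l h u a p = exchange N l h u' a p *:
    upwind N l h u' a p.
Proof.
move=> aN Op.
have [->|a0] := posnP a; first by rewrite !exchange0 !scale0r.
move: aN; rewrite leq_eqVlt => /orP[/eqP->|aN]; first by rewrite !exchangeN // !scale0r.
by rewrite /upwind exchangeE // !uu' ?a0 // ltnW.
Qed.

Lemma mass_equation_local p : Omega p ->
  mass_equation N l h u p -> mass_equation N l h u' p.
Proof.
move=> Op; rewrite /mass_equation => me; rewrite -[RHS]me; congr (_ + _).
by apply: eq_big_nat => a aN; rewrite divE.
Qed.

Lemma momentum_equation_local a p : (1 <= a <= N)%N -> Omega p ->
  momentum_equation g N l zb h u a p -> momentum_equation g N l zb h u' a p.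
Proof.
move=> aN Op; have aN1 : (a.-1 <= N)%N.
  by case/andP: aN => _; exact/leq_trans/leq_pred.
have E1 : 'D_(e_t R) (discharge l h u a) p = 'D_(e_t R) (discharge l h u' a) p.
  by apply: (dE _ Op) => q Oq; exact: dischargeE.
have E2 : div_tensor (discharge l h u a) (u a) p = div_tensor (discharge l h u' a) (u'
  a) p.
  have Ex : 'D_(e_x R) (fun q => (u a q).1 *: discharge l h u a q) p =
      'D_(e_x R) (fun q => (u' a q).1 *: discharge l h u' a q) p.
    by apply: (dE _ Op) => q Oq; rewrite (dischargeE aN Oq) (uu' aN Oq).
  have Ey : 'D_(e_y R) (fun q => (u a q).2 *: discharge l h u a q) p =
      'D_(e_y R) (fun q => (u' a q).2 *: discharge l h u' a q) p.
    by apply: (dE _ Op) => q Oq; rewrite (dischargeE aN Oq) (uu' aN Oq).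
  by rewrite /div_tensor Ex Ey.
by rewrite /momentum_equation (upwindE (andP aN).2 Op) (upwindE aN1 Op) E1 E2.
Qed.

End Locality.

Variable u : nat -> spacetime R -> velocity R.
Hypothesis u_C1 : forall a, (1 <= a <= N)%N -> Ck 1 Omega (u a).

(** By [exchange_diff] the jump of the exchange cancels the divergence of the layer itself and
    leaves [l a] times the total divergence; the time derivative is [l a] times that of [h], since
    the [l j] sum to 1. *)
Lemma mass_residualE a p : (1 <= a <= N)%N -> Omega p -> mass_residual N l h u a p =
  l a * (\sum_(1 <= j < N.+1) 'D_(e_t R) (layer_depth l h j) p
         + \sum_(1 <= j < N.+1) div (discharge l h u j) p).
Proof.
move=> aN Op.
have dH j : 'D_(e_t R) (layer_depth l h j) p = l j * 'D_(e_t R) h p.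
  by have [] := is_deriveZ (l j) (Ck_is_derive (e_t R) h_C1 Op).
have -> : \sum_(1 <= j < N.+1) 'D_(e_t R) (layer_depth l h j) p = 'D_(e_t R) h p.
  by rewrite (eq_bigr _ (fun j _ => dH j)) -mulr_suml l_sum mul1r.
rewrite /mass_residual (exchange_diff _ _ _ _ aN) dH.
by move: (div _ _) (\sum_(_ <= _ < _) _) ('D__ _ _) => x y z; ring.
Qed.

Lemma euler_residuals :
  (forall p, Omega p -> mass_equation N l h u p /\
     (forall a, (1 <= a <= N)%N -> momentum_equation g N l zb h u a p)) <->
  (forall p a, Omega p -> (1 <= a <= N)%N ->
     mass_residual N l h u a p = 0 /\ momentum_residual g N l zb h u a p = 0).
Proof.
split=> H p.
  move=> a Op aN; have [me Me] := H p Op; split; last exact/momentum_residualP/Me.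
  by rewrite mass_residualE // [X in _ * X]me mulr0.
move=> Op; split; last by move=> a aN; apply/momentum_residualP; exact: (H p a Op aN).2.
(* One layer suffices for the total mass equation, because its factor [l 1] is positive; a first
   layer exists since an empty sum could not be 1. *)
have N1 : (1 <= 1 <= N)%N by rewrite N_gt0.
have [] := H p 1%N Op N1; rewrite mass_residualE // => /eqP.
by rewrite mulf_eq0 gt_eqF ?l_gt0 //= => /eqP.
Qed.

Lemma residuals_kinetic_solution :
  (forall p a, Omega p -> (1 <= a <= N)%N ->
     mass_residual N l h u a p = 0 /\ momentum_residual g N l zb h u a p = 0) ->
  kinetic_solution g N l zb Omega h u.
Proof.
move=> H; exists (kinetic_operator g N l zb Omega h u) => a aN.
have moment0 (a0 a1 a2 : R) (w : velocity R -> R) :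
    (forall z, w z = a0 + a1 * z.1 + a2 * z.2) ->
    vanishing_moment Omega (kinetic_operator g N l zb Omega h u a) w.
  move=> wE; exists (fun=> 0); split; last first.
    exact: aeW.
  split=> [K _ _|phi tphi]; first exact: integrable0.
  have [r Hr] := kinetic_moment g_gt0 l_sum Omega_open zb_C1 h_C1 u_C1 h_gt0 aN tphi.
  exists r => chi tchi chi1.
  rewrite (_ : (fun q : phase R => _) =
    fun q => phi q.1 * ((a0 + a1 * q.2.1 + a2 * q.2.2) * chi q.2)); last first.
    by apply/funext => q; rewrite wE.
  rewrite Hr //; apply: eq_Rintegral => p; rewrite inE => Op.
  by have [-> ->] := H p a Op aN; rewrite /= !mulr0 !addr0.
split=> //.
- exact: kinetic_operator_distribution.
- by apply: (moment0 1 0 0) => z; ring.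
- by apply: (moment0 0 1 0) => z; ring.
- by apply: (moment0 0 0 1) => z; ring.
Qed.

Lemma kinetic_solution_residuals : kinetic_solution g N l zb Omega h u ->
  forall p a, Omega p -> (1 <= a <= N)%N ->
     mass_residual N l h u a p = 0 /\ momentum_residual g N l zb h u a p = 0.
Proof.
move=> [Q HQ] p a Op aN; have [_ QE V0 V1 V2] := HQ a aN.
have residual0 (a0 a1 a2 : R) (w : velocity R -> R) :
    (forall z, w z = a0 + a1 * z.1 + a2 * z.2) -> vanishing_moment Omega (Q a) w ->
    a0 * mass_residual N l h u a p + a1 * (momentum_residual g N l zb h u a p).1
      + a2 * (momentum_residual g N l zb h u a p).2 = 0.
  move=> wE [m [[im Hm] m0]].
  have cE : cont_on Omega (fun p => a0 * mass_residual N l h u a p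
      + a1 * (momentum_residual g N l zb h u a p).1
      + a2 * (momentum_residual g N l zb h u a p).2) by exact: residual_cont.
  apply: (fundamental_lemma Omega_open cE _ Op) => phi tphi.
  have [r Hr] := kinetic_moment g_gt0 l_sum Omega_open zb_C1 h_C1 u_C1 h_gt0 aN tphi.
  have [r' Hr'] := Hm phi tphi.
  (* A single cutoff large enough both for the moment of [Q a] and for that of the kinetic operator;
     on the resulting test function the two sides are the same number. *)
  pose s := Num.max r r'; have tchi := cutoff_test s.
  have chi1 z : `|z| <= r -> cutoff s z = 1.
    by move=> zr; apply: cutoff_eq1; rewrite (le_trans zr) // le_max lexx.
  have chi1' z : `|z| <= r' -> cutoff s z = 1.
    by move=> zr; apply: cutoff_eq1; rewrite (le_trans zr) // le_max lexx orbT.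
  rewrite -(Hr _ a0 a1 a2 tchi chi1).
  have tPhi : test_function (phase_domain Omega)
      (fun q : phase R => phi q.1 * ((a0 + a1 * q.2.1 + a2 * q.2.2) * cutoff s q.2)).
    apply: (test_function_tensor
      (g := fun z => (a0 + a1 * z.1 + a2 * z.2) * cutoff s z) tphi).
    by split; [exact: cutoff_smooth|exact: cutoff_compact|exact: subsetT].
  rewrite (QE _ tPhi) -(Rintegral_ae_zero Omega_open im m0 tphi) -(Hr' _ tchi chi1').
  by congr (Q a _); apply/funext => q; rewrite wE.
have e0 := residual0 1 0 0 _ _ V0; have e1 := residual0 0 1 0 _ _ V1.
have e2 := residual0 0 0 1 _ _ V2.
split; first by rewrite -[RHS]e0 => [|z]; ring.
rewrite [LHS]surjective_pairing; congr pair.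
  by rewrite -[RHS]e1 => [|z]; ring.
by rewrite -[RHS]e2 => [|z]; ring.
Qed.

End Equivalence.

Theorem proposition4p1 (R : realType) (g : R) (N : nat) (l : nat -> R)
    (zb : R * R -> R) (Omega : set (spacetime R))
    (h : spacetime R -> R) (u : nat -> spacetime R -> velocity R)
    (g_gt0 : 0 < g)
    (l_gt0 : forall a, (1 <= a <= N)%N -> 0 < l a)
    (l_sum : \sum_(1 <= a < N.+1) l a = 1)
    (Omega_open : open Omega)
    (zb_C1 : Ck 1 Omega (fun p : spacetime R => zb p.2))
    (h_C1 : Ck 1 Omega h)
    (u_C1 : forall a, (1 <= a <= N)%N -> Ck 1 Omega (u a))
    (h_gt0 : forall p, Omega p -> 0 < h p) :
  euler_strong_solution g N l zb Omega h (layered_velocity N l zb h u) <->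
  kinetic_solution g N l zb Omega h u.
Proof.
have [E1 E2] := euler_residuals g zb l_gt0 l_sum h_C1 u.
split=> [[_ [u' [_ uu' Hu']]]|K].
  apply: residuals_kinetic_solution => //; apply: E1 => p Op.
  (* The family [u'] is tied to [u] only through the layered field; both are read off at the
     midpoint of layer [a]. The interfaces depend on [h] and [zb] alone, so the midpoint is the same
     for both. *)
  have u'u a q : (1 <= a <= N)%N -> Omega q -> u' a q = u a q.
    move=> aN Oq.
    by rewrite -(layered_velocityE zb l_gt0 u' aN (h_gt0 _ Oq)) -uu' //
      layered_velocityE ?h_gt0.
  have [me Me] := Hu' p Op; split.
    exact: (mass_equation_local Omega_open u'u).
  move=> a aN; exact: (momentum_equation_local l_sum Omega_open u'u aN Op (Me a aN)).
split=> //; exists u; split=> //; apply: E2.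
exact: (kinetic_solution_residuals g_gt0).
Qed.
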